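(* For Lebesgue almost every $\beta\in(1,\sqrt2)$, for Lebesgue almost every $x\in I_\beta$, the probability measures $\mu_{n,x}$ converge weakly, as $n\to\infty$, to the normalised Lebesgue measure on $I_\beta$.
   Context: For $\beta\in(1,2)$, $I_\beta=[0,\frac1{\beta-1}]$; $T_i(x)=\beta x-i$ for $i\in\{0,1\}$ and $T_{a_1\cdots a_n}=T_{a_n}\circ\cdots\circ T_{a_1}$ for $a_1\cdots a_n\in\{0,1\}^n$. For $x\in I_\beta$, $\mathcal O^n(x)$ is the multiset $\{T_{a_1\cdots a_n}(x): a_1\cdots a_n\in\{0,1\}^n,\ T_{a_1\cdots a_n}(x)\in I_\beta\}$, where the multiplicity of $y$ is the number of words $a_1\cdots a_n$ with $T_{a_1\cdots a_n}(x)=y$ (equivalently, the words range over those which are prefixes of some $\beta$-expansion $\underline a\in\{0,1\}^{\mathbb N}$, $\sum_i a_i\beta^{-i}=x$, of $x$). $\mathcal N_n(x;\beta)=|\mathcal O^n(x)|=|\{a_1\cdots a_n\in\{0,1\}^n:T_{a_1\cdots a_n}(x)\in I_\beta\}|$, and $$\mu_{n,x}=\frac1{\mathcal N_n(x;\beta)}\sum_{y\in\mathcal O^n(x)}\delta_y,$$ the sum being taken with multiplicity. Normalised Lebesgue measure on $I_\beta$ is Lebesgue measure restricted to $I_\beta$ multiplied by $\beta-1$. *)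

(* Defs.v *)
From HB Require Import structures.
From mathcomp Require Import all_boot all_order all_algebra.
From mathcomp Require Import all_classical all_reals all_analysis.

Set Implicit Arguments.
Unset Strict Implicit.
Unset Printing Implicit Defensive.

Import Order.TTheory GRing.Theory Num.Theory.
Import numFieldTopology.Exports numFieldNormedType.Exports.

Local Open Scope classical_set_scope.
Local Open Scope ring_scope.

Section beta_expansions.
Context {R : realType}.
Implicit Types (beta x : R) (n : nat).

Definition Ibeta beta : interval R := `[0, (beta - 1)^-1].

(* Digits are booleans, read as 0 and 1 through the coercion to nat. *)
Definition Tdigit beta (a : bool) (x : R) : R := beta * x - a%:R.

(* The first letter of the word is applied first. *)
Definition Tword beta (w : seq bool) (x : R) : R :=
  foldl (fun y a => Tdigit beta a y) x w.

(* A multiset is represented by the sequence of its elements, repeated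
   according to multiplicity: one entry for each admissible word, even when
   several words give the same point. *)
Definition orbit_multiset beta x n : seq R :=
  [seq Tword beta w x |
     w : n.-tuple bool in [pred w : n.-tuple bool |
                             Tword beta w x \in Ibeta beta]].

Definition orbit_count beta x n : nat := size (orbit_multiset beta x n).

(* A measure on the whole line carried by [Ibeta beta].  For [1 < beta < 2] it
   is a probability when [x] is in [Ibeta beta] ([orbit_measure_setT] below);
   for other [x] there is no admissible word and it is the null measure. *)
Definition orbit_measure beta x n :
    {measure set (measurableTypeR R) -> \bar R} :=
  mscale ((orbit_count beta x n)%:R^-1)%:nng
    (msum (fun k => \d_((orbit_multiset beta x n)`_k : measurableTypeR R))
       (orbit_count beta x n)).

Lemma subr1_ge0 beta : 1 < beta -> 0 <= beta - 1.
Proof. by move=> b1; rewrite subr_ge0 ltW. Qed.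

Definition normalised_lebesgue beta (b1 : 1 < beta) :
    {measure set (measurableTypeR R) -> \bar R} :=
  mscale (NngNum (subr1_ge0 b1))
    (mrestr lebesgue_measure (measurable_itv (Ibeta beta))).

(* For finite measures: both sides are then finite, so that convergence in
   [\bar R] is convergence in [R]. *)
Definition weakly_converges
    (mu_ : nat -> {measure set (measurableTypeR R) -> \bar R})
    (mu : {measure set (measurableTypeR R) -> \bar R}) : Prop :=
  forall f : R -> R, continuous f -> bounded_fun f ->
    (\int[mu_ n]_x (f x)%:E)%E @[n --> \oo] --> (\int[mu]_x (f x)%:E)%E.

Lemma orbit_countE beta x n : orbit_count beta x n =
  #|[set w : n.-tuple bool | Tword beta w x \in Ibeta beta]%SET|.
Proof. by rewrite /orbit_count size_image cardsE. Qed.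

Lemma orbit_measureE beta x n (A : set R) : orbit_measure beta x n A =
  (((orbit_count beta x n)%:R^-1)%:E *
     \sum_(y <- orbit_multiset beta x n) \d_y A)%E.
Proof.
by rewrite /orbit_measure /mscale /= /msum (big_nth 0%R) big_mkord.
Qed.

Lemma normalised_lebesgueE beta (b1 : 1 < beta) (A : set R) :
  normalised_lebesgue b1 A =
  ((beta - 1)%:E * lebesgue_measure (A `&` [set` Ibeta beta]))%E.
Proof. by []. Qed.

Lemma orbit_count_gt0 beta x n :
  1 < beta < 2 -> x \in Ibeta beta -> (0 < orbit_count beta x n)%N.
Proof.
move=> /andP[b1 b2]; have b0 : 0 < beta - 1 by rewrite subr_gt0.
have cb : (beta - 1)^-1 * beta = 1 + (beta - 1)^-1.
  by rewrite -{2}(subrK 1 beta) mulrDr mulVf ?gt_eqF// mulr1.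
suff H m : forall y, y \in Ibeta beta ->
    exists2 w : m.-tuple bool, true & Tword beta w y \in Ibeta beta.
  move=> xI; rewrite orbit_countE card_gt0; apply/set0Pn.
  by have [w _ wI] := H n x xI; exists w; rewrite inE.
elim: m => [|m IH] y yI; first by exists [tuple].
suff [a aI] : exists a, Tdigit beta a y \in Ibeta beta.
  by have [w _ wI] := IH _ aI; exists [tuple of a :: w].
move: yI; rewrite /Ibeta in_itv/= => /andP[y0 y1].
have [y1b|y1b] := lerP (beta * y) 1.
  exists false; rewrite /Tdigit subr0 in_itv/= mulr_ge0 ?(ltW (lt_trans ltr01 b1))//=.
  rewrite (le_trans y1b)// invf_ge1// lerBlDr; exact: ltW.
exists true; rewrite /Tdigit in_itv/= subr_ge0 (ltW y1b)/= lerBlDl -cb mulrC.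
by rewrite ler_wpM2r// ltW// (lt_trans ltr01 b1).
Qed.

Lemma orbit_measure_setT beta x n :
  1 < beta < 2 -> x \in Ibeta beta -> orbit_measure beta x n setT = 1%E.
Proof.
move=> b12 xI; have N0 := orbit_count_gt0 n b12 xI.
rewrite orbit_measureE; under eq_bigr do rewrite diracT.
rewrite sumEFin -EFinM big_const_seq count_predT iter_addr_0.
by rewrite mulVf// pnatr_eq0 -lt0n.
Qed.

Lemma normalised_lebesgue_setT beta (b1 : 1 < beta) :
  normalised_lebesgue b1 setT = 1%E.
Proof.
have b0 : 0 < beta - 1 by rewrite subr_gt0.
rewrite normalised_lebesgueE setTI lebesgue_measure_itv/= lte_fin invr_gt0 b0.
by rewrite -EFinB subr0 -EFinM mulfV// gt_eqF.
Qed.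

End beta_expansions.

(* Main.v *)
Require Import Defs.
From HB Require Import structures.
From mathcomp Require Import all_boot all_order all_algebra.
From mathcomp Require Import all_classical all_reals all_analysis.
From mathcomp Require Import unstable measurable_realfun ring lra zify.

Set Implicit Arguments.
Unset Strict Implicit.
Unset Printing Implicit Defensive.

Import Order.TTheory GRing.Theory Num.Theory.
Import numFieldTopology.Exports numFieldNormedType.Exports.

Local Open Scope classical_set_scope.
Local Open Scope ring_scope.

(** Put L = 1 / (beta - 1) and P f (x) = beta / 2 * (f (beta x) + f (beta x - 1)).
    For an indicator f of [0, c], the value P^n f (x) is (beta / 2)^n times the
    number of words of length n that send x into [0, c]; it is [transfer n c x].
    The orbit of x equidistributes as soon as, for every rational a in [0, 1],
    the [discrepancy] V_n = P^n (1_[0, a L] - a 1_[0, L]) is negligible at x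
    compared with T_n = P^n 1_[0, L].  For almost every beta and almost every x,
    V_n (x) is O(k^(3n/2)) for some k < 1 ([ae_discrepancy_le]), while T_n (x) is
    at least a constant times k^n ([ae_slow_decay]).

    Decay of V_n, in mean square.  P^n f (x) is an average of translates of
    f (beta^n x) by the subset sums of 1, beta, ..., beta^(n-1).  Averaging
    translates contracts the L^2 norm, so the digits whose index is not a
    multiple of a chosen q may be dropped ([posdef_davgs_le]).  As
    beta < sqrt 2, some q puts z = beta^q in (25/16, 2)
    ([exists_window_power]).  About m = n / q digits remain, and the square of
    the norm is at most L z^m times the [energy]: the mean of psi at the
    random points (beta - 1) sum_(j < m) d_j z^j, with d_j = 0, 1, -1 of
    probabilities 1/2, 1/4, 1/4 and psi the autocorrelation of
    1_[0, a] - a 1_[0, 1].  The energy is O(2^-m) in mean over beta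
    ([weighted_energy_le]), which beats z^m because z < 2.  Indeed, if the
    highest index with d_j nonzero is k, an event of probability 2^-(m-k),
    the point is up to sign a polynomial in z with leading term z^k and
    coefficients at most 1 in absolute value.  For z >= 25/16 such polynomials
    are transverse to zero ([transversality]), so that the point lies in the
    support of psi for a set of beta of measure O(z^-k) only.  Moreover psi has
    a compactly supported antiderivative, because 1_[0, a] - a 1_[0, 1] has zero
    mean; integrating by parts in beta gains a second factor z^-k, up to a power
    of k ([oscillatory_integral_le]).  The contribution of k is thus
    O(2^-(m-k) k^3 (25/16)^(-2k)), and (25/16)^2 > 2 makes the sum O(2^-m).

    Lower bound for T_n.  One step of P costs a factor k up to discrepancies,
    which are summable in mean; since the integral of T_n is constantly L, the
    set of x with T_n (x) >= c k^n for large n is not negligible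
    ([not_ae_not_slow_decay]).  That set is stable under x / beta and
    (x + 1) / beta, so that it occupies a fixed proportion of some interval at
    every scale around every point of [0, L]; by the density theorem its
    complement is negligible ([self_similar_conull]). *)

(** * Autocorrelation of a centred interval *)

Section autocorrelation.
Context {R : realType}.
Implicit Types (y c a : R) (g : R -> R).

Definition ramp y : R := Num.max y 0.
(** An antiderivative of [ramp]. *)
Definition ramp2 y : R := ramp y ^+ 2 / 2.

(** For [g := ramp] and nonnegative [c] and [c'], the length of
    [0, c] cap ([0, c'] - y), see [ramp_overlap].  Other functions [g] serve to
    integrate this expression in [y]. *)
Definition overlap g c c' y : R := g (y + c) - g y - g (y + c - c') + g (y - c').

(** For [g := ramp], the autocorrelation of 1_[0, a] - a 1_[0, 1]; for
    [g := ramp2], an antiderivative of it. *)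
Definition autocorr g a y : R :=
  overlap g a a y - a * overlap g a 1 y - a * overlap g 1 a y
  + a ^+ 2 * overlap g 1 1 y.

Lemma ramp_ge0 y : 0 <= ramp y.
Proof. by rewrite /ramp le_max lexx orbT. Qed.

Lemma ramp_pos y : 0 <= y -> ramp y = y.
Proof. by move=> y0; apply/max_idPl. Qed.

Lemma ramp_neg y : y <= 0 -> ramp y = 0.
Proof. by move=> y0; apply/max_idPr. Qed.

Lemma ramp_le2 y : y <= 2 -> ramp y <= 2.
Proof. by move=> y2; rewrite /ramp ge_max y2/=. Qed.

Lemma rampN y : ramp (- y) = ramp y - y.
Proof.
have [y0|/ltW y0] := leP 0 y.
  by rewrite (ramp_pos y0) ramp_neg ?subrr// oppr_le0.
by rewrite (ramp_neg y0) ramp_pos ?sub0r// oppr_ge0.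
Qed.

(** The antiderivative has compact support as well: this is where the zero mean
    of 1_[0, a] - a 1_[0, 1] enters.  For [y >= 1] all ramps are affine, and the
    coefficients kill the quadratic terms. *)
Lemma autocorr_ramp_far a y : 0 <= a <= 1 -> 1 <= `|y| ->
  autocorr ramp a y = 0 /\ autocorr ramp2 a y = 0.
Proof.
move=> /andP[a0 a1]; rewrite ler_normr => /orP[y1|y1]; rewrite /autocorr /overlap /ramp2.
- by rewrite !ramp_pos; [split; field|lra..].
- by rewrite !ramp_neg; [split; field|lra..].
Qed.

Lemma overlap_bound g c c' y : (forall y, y <= 2 -> 0 <= g y <= 2) ->
  0 <= c <= 1 -> 0 <= c' <= 1 -> `|y| <= 1 -> `|overlap g c c' y| <= 4.
Proof.
move=> g2 /andP[c0 c1] /andP[c0' c1']; rewrite ler_norml => /andP[y0 y1].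
have := g2 (y + c); have := g2 y; have := g2 (y + c - c'); have := g2 (y - c').
move=> /(_ ltac:(lra))/andP[? ?] /(_ ltac:(lra))/andP[? ?].
move=> /(_ ltac:(lra))/andP[? ?] /(_ ltac:(lra))/andP[? ?].
by rewrite /overlap ler_norml; lra.
Qed.

Lemma autocorr_bound g a y : (forall y, y <= 2 -> 0 <= g y <= 2) ->
  0 <= a <= 1 -> `|y| <= 1 -> `|autocorr g a y| <= 16.
Proof.
move=> g2 a01 y1; have /andP[a0 a1] := a01.
have o01 : 0 <= (1 : R) <= 1 by rewrite ler01 lexx.
have := overlap_bound g2 a01 a01 y1; have := overlap_bound g2 a01 o01 y1.
have := overlap_bound g2 o01 a01 y1; have := overlap_bound g2 o01 o01 y1.
rewrite /autocorr.
move: (overlap _ _ _ _) (overlap _ _ _ _) (overlap _ _ _ _) (overlap _ _ _ _).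
move=> p q r s hp hq hr hs.
have shrink (b t : R) : 0 <= b <= 1 -> `|t| <= 4 -> `|b * t| <= 4.
  move=> /andP[b0 b1] t4; rewrite normrM (ger0_norm b0).
  by rewrite (le_trans _ t4)// ler_piMl.
have a2 : 0 <= a ^+ 2 <= 1 by rewrite expr_le1 // exprn_ge0.
have := shrink _ _ a01 hq; have := shrink _ _ a01 hr; have := shrink _ _ a2 hp.
move: hs (shrink _ _ a01 hr).
rewrite !ler_norml => /andP[? ?] /andP[? ?] /andP[? ?] /andP[? ?] /andP[? ?].
by apply/andP; split; lra.
Qed.

Lemma autocorr_ramp_bound a y : 0 <= a <= 1 -> `|autocorr ramp a y| <= 16.
Proof.
move=> a01; have [y1|/ltW y1] := leP `|y| 1; last first.
  by have [-> _] := autocorr_ramp_far a01 y1; rewrite normr0.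
by apply: autocorr_bound => // t t2; rewrite ramp_ge0 ramp_le2.
Qed.

Lemma autocorr_ramp2_bound a y : 0 <= a <= 1 -> `|autocorr ramp2 a y| <= 16.
Proof.
move=> a01; have [y1|/ltW y1] := leP `|y| 1; last first.
  by have [_ ->] := autocorr_ramp_far a01 y1; rewrite normr0.
apply: autocorr_bound => // t t2; have := ramp_ge0 t; have := ramp_le2 t2.
by rewrite /ramp2 => ? ?; apply/andP; split; nra.
Qed.

Lemma autocorr_rampN a y : autocorr ramp a (- y) = autocorr ramp a y.
Proof.
have E c : ramp (- y + c) = ramp (y - c) - (y - c).
  by rewrite -rampN; congr ramp; ring.
have E' c c' : ramp (- y + c - c') = ramp (y + c' - c) - (y + c' - c).
  by rewrite -rampN; congr ramp; ring.
rewrite /autocorr /overlap !E' !E rampN !opprK.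
by ring.
Qed.

Lemma ramp_continuous : continuous (@ramp).
Proof. by move=> y; apply: continuous_max => //; exact: cst_continuous. Qed.

(** This form is convenient at the origin, where [ramp2] is C^1 but not C^2. *)
Lemma ramp2E y : ramp2 y = (y ^+ 2 + y * `|y|) / 4.
Proof.
rewrite /ramp2; have [y0|/ltW y0] := leP 0 y.
  by rewrite ramp_pos// ger0_norm//; field.
by rewrite ramp_neg// ler0_norm//; field.
Qed.

Lemma is_derive_ramp2 y : is_derive y 1 ramp2 (ramp y).
Proof.
have [y0|y0|->] := ltgtP y 0.
- rewrite ramp_neg ?ltW//.
  apply: (@near_eq_is_derive _ _ _ (cst 0)).
    near=> t; have t0 : t < 0 by near: t; exact: lt_nbhsl.
    by rewrite /ramp2 ramp_neg ?(ltW t0)// expr0n mul0r.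
- rewrite ramp_pos ?ltW//.
  have D : is_derive y 1 ((id : R -> R) ^+ 2 * cst 2^-1) y.
    by apply: is_derive_eq; rewrite /GRing.scale/=; field.
  apply: near_eq_is_derive D.
  near=> t; have t0 : 0 < t by near: t; exact: lt_nbhsr.
  by rewrite /ramp2 ramp_pos ?(ltW t0).
- rewrite ramp_pos//; have E : (fun h : R => h^-1 *: ((ramp2 \o shift 0) (h *: 1) - ramp2 0))
      @ 0^' --> (0 : R).
    have F : {near 0^', (fun h : R => (h + `|h|) / 4) =1
        (fun h : R => h^-1 *: ((ramp2 \o shift 0) (h *: 1) - ramp2 0))}.
      near=> h; have h0 : h != 0 by near: h; exact: nbhs_dnbhs_neq.
      rewrite /= !ramp2E /GRing.scale/= mulr1 addr0 normr0; by field; rewrite h0.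
    apply: cvg_trans (near_eq_cvg F) _.
    have C : (fun h : R => (h + `|h|) / 4) @ 0^' --> (0 + `|0 : R|) / 4.
      by apply: cvgMl; apply: cvgD; [|apply: cvg_norm]; exact: cvg_within.
    by rewrite normr0 addr0 mul0r in C.
  by apply: DeriveDef; [exact: cvgP E|exact: cvg_lim E].
Unshelve. all: by end_near. Qed.

Lemma is_derive_ramp2_shift c y :
  is_derive y 1 (fun t => ramp2 (t + c)) (ramp (y + c)).
Proof.
have := @is_derive1_comp _ ramp2 (fun t => t + c) y _ _ (is_derive_ramp2 (y + c))
  (is_derive_shift y 1 c).
by move=> D; apply: is_derive_eq D _; rewrite ?mulr1 ?mul1r ?scaler1 ?scale1r.
Qed.

Lemma is_derive_autocorr a y :
  is_derive y 1 (autocorr ramp2 a) (autocorr ramp a y).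
Proof.
have D c : is_derive y 1 (fun t => ramp2 (t + c)) (ramp (y + c)).
  exact: is_derive_ramp2_shift.
have -> : autocorr ramp2 a = let g c := fun t => ramp2 (t + c) in
    let o c c' := g c - g 0 - g (c - c') + g (- c') in
    o a a - cst a * o a 1 - cst a * o 1 a + cst (a ^+ 2) * o 1 1.
  by apply/funext => t; rewrite /autocorr /overlap /= !fctE /= addr0 !addrA.
apply: is_derive_eq.
rewrite /= !fctE /GRing.scale/= /autocorr /overlap !addr0 !addrA.
by ring.
Qed.

Lemma autocorr_ramp_continuous a : continuous (autocorr ramp a).
Proof.
have C c : continuous (fun y => ramp (y + c)).
  move=> y; apply: (@continuous_comp _ _ _ (fun y => y + c) ramp).
    by apply: continuousD; [exact: cvg_id|exact: cst_continuous].
  exact: ramp_continuous.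
have Co c c' : continuous (overlap ramp c c').
  move=> y; rewrite /overlap; apply: cvgD; last exact: C.
  apply: cvgB; last first.
    by under eq_fun do rewrite -addrA; rewrite -addrA; exact: C.
  by apply: cvgB; [exact: C|exact: ramp_continuous].
move=> y; rewrite /autocorr; apply: cvgD; [apply: cvgB; [apply: cvgB|]|].
- exact: Co.
- by apply: cvgMr; exact: Co.
- by apply: cvgMr; exact: Co.
- by apply: cvgMr; exact: Co.
Qed.

End autocorrelation.

(** * An oscillatory integral *)

Section oscillation.
Context {R : realType}.
Local Notation mu := (@lebesgue_measure R).

(** A weight that vanishes at both ends, so that integration by parts leaves no
    boundary terms. *)
Definition bump (b0 b1 : R) : {poly R} := ('X - b0%:P) * (b1%:P - 'X).

Lemma continuous_at_itv_integrable (b0 b1 : R) (f : R -> R) :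
  (forall x, x \in `[b0, b1] -> {for x, continuous f}) ->
  mu.-integrable `[b0, b1] (EFin \o f).
Proof.
move=> cf; apply: continuous_compact_integrable; first exact: segment_compact.
by apply: continuous_in_subspaceT => x /[!inE] xI; exact: cf.
Qed.

Lemma Rintegral_FTC (b0 b1 : R) (F f : R -> R) : b0 < b1 ->
  (forall x, x \in `[b0, b1] -> {for x, continuous f}) ->
  (forall x, x \in `[b0, b1] -> is_derive x 1 F (f x)) ->
  \int[mu]_(x in `[b0, b1]) f x = F b1 - F b0.
Proof.
move=> b01 cf dF.
have cF x : x \in `[b0, b1] -> {for x, continuous F}.
  move=> /dF [dFx _]; apply/differentiable_continuous.
  exact/derivable1_diffP.
rewrite /Rintegral (@continuous_FTC2 _ f F)//.
- by apply: continuous_in_subspaceT => x /[!inE] xI; exact: cf.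
- split.
  + by move=> x /subset_itv_oo_cc /dF[].
  + by apply: cvg_at_right_filter; apply: cF; rewrite in_itv/= lexx ltW.
  + by apply: cvg_at_left_filter; apply: cF; rewrite in_itv/= lexx ltW.
- by move=> x /subset_itv_oo_cc /dF dFx; rewrite derive1E derive_val.
Qed.

Lemma normr_Rintegral_le_support (b0 b1 : R) (f : R -> R) (M c d : R) :
  (forall x, x \in `[b0, b1] -> {for x, continuous f}) ->
  0 <= M -> 0 <= d ->
  (forall x, x \in `[b0, b1] -> `|f x| <= M) ->
  (forall x, x \in `[b0, b1] -> f x != 0 -> `|x - c| <= d) ->
  `| \int[mu]_(x in `[b0, b1]) f x | <= M * (2 * d).
Proof.
move=> cf M0 d0 fM fs.
have If := continuous_at_itv_integrable cf.
apply: le_trans (le_normr_Rintegral _ If) _ => //.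
pose S := `[b0, b1]%classic `&` `[c - d, c + d]%classic.
have mS : measurable S by exact: measurableI.
rewrite -lee_fin fineK; last first.
  apply: integrable_fin_num => //.
  by have := integrable_norm If.
apply: (@le_trans _ _ (\int[mu]_(x in `[b0, b1]) (M * \1_S x)%:E)%E).
  apply: ge0_le_integral => //.
  - apply/measurable_EFinP; apply: measurableT_comp => //.
    by case/integrableP: If => /measurable_EFinP.
  - by apply/measurable_EFinP; apply: measurable_funM => //; exact: measurable_indic.
  - move=> x xI; rewrite lee_fin indicE.
    have [xS|xS] := boolP (x \in S); first by rewrite mulr1 fM.
    have [->|f0] := eqVneq (f x) 0; first by rewrite normr0 mulr0.
    have := fs _ xI f0; rewrite ler_distl => xcd.
    by move: xS; rewrite notin_setE; case; split => //=; rewrite in_itv.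
under eq_integral do rewrite EFinM.
rewrite (@ge0_integralZl_EFin _ _ _ mu _ _ (EFin \o \1_S))//; last 2 first.
- by move=> x _; rewrite lee_fin.
- by apply/measurable_EFinP; exact: measurable_indic.
rewrite /= integral_indic// EFinM lee_wpmul2l ?lee_fin//.
apply: (@le_trans _ _ (mu `[c - d, c + d]%classic)).
  by apply: le_measure; rewrite ?inE//; [exact: measurableI|move=> x [[_ ?] _]].
rewrite lebesgue_measure_itv/= lte_fin; case: ifPn => _.
  by rewrite -EFinB lee_fin; lra.
by rewrite lee_fin mulr_ge0.
Qed.

Lemma is_derive_horner_inv (v : {poly R}) (x : R) : v.[x] != 0 ->
  is_derive x 1 (fun x => (v.[x])^-1) (- v.[x] ^- 2 * v^`().[x]).
Proof.
move=> vx; have dv := @derivable_horner _ v x.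
by apply: DeriveDef; [exact: derivableV|rewrite deriveV// derive_val].
Qed.

(** Integration by parts along the vector field [x / v].  If [x y' = v] held
    exactly, [rho * f y] would be [rho * x / v] times the derivative of [F y], and
    its integral would be minus that of [F y] times the derivative of
    [rho * x / v].  An error [x y' - v] proportional to [y] is harmless: it only
    matters where [f y] is nonzero, and [y] is bounded there.  Both remaining
    integrands are bounded and supported where [`|y| < 1], a set of diameter at
    most [2 d]. *)
Lemma oscillatory_integral_le (b0 b1 : R) (F f : R -> R) (K : R)
    (y v : {poly R}) (E B c d : R) :
  let rho := bump b0 b1 in
  b0 < b1 -> 0 <= K -> 0 <= E -> 0 <= d -> 0 <= B ->
  (forall t : R, is_derive t 1 F (f t)) -> continuous f ->
  (forall t, `|F t| <= K) -> (forall t, `|f t| <= K) ->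
  (forall t, 1 <= `|t| -> F t = 0 /\ f t = 0) ->
  (forall x, x \in `[b0, b1] -> 0 < v.[x]) ->
  (forall x, x \in `[b0, b1] -> `|x * y^`().[x] - v.[x]| <= E * `|y.[x]|) ->
  (forall x, x \in `[b0, b1] -> `|rho.[x]| * E / v.[x] <= B) ->
  (forall x, x \in `[b0, b1] ->
    `|((rho * 'X)^`().[x] * v.[x] - (rho * 'X).[x] * v^`().[x]) / v.[x] ^+ 2| <= B) ->
  (forall x, x \in `[b0, b1] -> `|y.[x]| < 1 -> `|x - c| <= d) ->
  `| \int[mu]_(x in `[b0, b1]) (rho.[x] * f y.[x]) | <= 4 * K * B * d.
Proof.
move=> rho b01 K0 E0 d0 B0 dF cf FK fK far v0 hE hB hA hS.
have v0' x : x \in `[b0, b1] -> v.[x] != 0 by move=> /v0; rewrite lt0r => /andP[].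
pose A x := ((rho * 'X)^`().[x] * v.[x] - (rho * 'X).[x] * v^`().[x]) / v.[x] ^+ 2.
pose g x := f y.[x] * (rho.[x] * (x * y^`().[x] - v.[x]) / v.[x]) + F y.[x] * A x.
pose H x := F y.[x] * ((rho * 'X).[x] / v.[x]).
pose h x := rho.[x] * f y.[x].
have ch p : continuous (horner p : R -> R) by exact: continuous_horner.
have cF : continuous F.
  by move=> t; apply/differentiable_continuous/derivable1_diffP; case: (dF t).
have cfy x : {for x, continuous (fun x => f y.[x])}.
  by apply: (@continuous_comp _ _ _ (horner y) f); [exact: ch|exact: cf].
have cFy x : {for x, continuous (fun x => F y.[x])}.
  by apply: (@continuous_comp _ _ _ (horner y) F); [exact: ch|exact: cF].
have cg x : x \in `[b0, b1] -> {for x, continuous g}.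
  move=> xI; apply: cvgD; apply: cvgM; [exact: cfy| |exact: cFy|].
  - apply: cvgM; last by apply: cvgV; [exact: v0'|exact: ch].
    apply: cvgM; first exact: ch.
    by apply: cvgB; [apply: cvgM; [exact: cvg_id|exact: ch]|exact: ch].
  - apply: cvgM; first by apply: cvgB; apply: cvgM; exact: ch.
    apply: cvgV; first by rewrite expf_neq0// v0'.
    by apply: cvgM; exact: ch.
have chh x : x \in `[b0, b1] -> {for x, continuous h}.
  by move=> xI; apply: cvgM; [exact: ch|exact: cfy].
have dH x : x \in `[b0, b1] -> is_derive x 1 H (h x + g x).
  move=> xI.
  have D1 : is_derive x 1 (F \o horner y) (f y.[x] * y^`().[x]).
    by apply: is_derive1_comp.
  have D2 : is_derive x 1 (fun x => (v.[x])^-1) (- v.[x] ^- 2 * v^`().[x]).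
    exact: is_derive_horner_inv (v0' _ xI).
  have D3 := is_deriveM D1 (is_deriveM (is_derive_poly (rho * 'X) x) D2).
  apply: is_derive_eq D3 _.
  rewrite /h /g /A /GRing.scale/= !fctE; have := v0' _ xI; set V := v.[x] => V0.
  by rewrite hornerM hornerX; field; exact: V0.
have : \int[mu]_(x in `[b0, b1]) (h x + g x) = 0.
  rewrite (Rintegral_FTC b01 _ dH).
    rewrite /H !hornerM /bump !(hornerD, hornerN, hornerC, hornerX).
    by rewrite !subrr; ring.
  by move=> x xI; apply: cvgD; [exact: chh|exact: cg].
rewrite RintegralD//; [|exact: continuous_at_itv_integrable..].
move=> /eqP; rewrite addr_eq0 => /eqP ->; rewrite normrN.
have -> : 4 * K * B * d = (2 * K * B) * (2 * d) by ring.
apply: (normr_Rintegral_le_support cg (c := c)) => //.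
- by rewrite !mulr_ge0.
- move=> x xI; apply: le_trans (ler_normD _ _) _.
  have -> : 2 * K * B = K * B + K * B by ring.
  apply: lerD; last by rewrite normrM; apply: ler_pM => //; exact: hA.
  have [y1|y1] := leP 1 `|y.[x]|.
    by have [_ ->] := far _ y1; rewrite mul0r normr0 mulr_ge0.
  rewrite normrM; apply: ler_pM => //.
  rewrite !normrM normfV (gtr0_norm (v0 _ xI)).
  apply: le_trans (hB _ xI).
  rewrite ler_pM2r ?invr_gt0 ?v0// ler_wpM2l//.
  apply: le_trans (hE _ xI) _; rewrite -[leRHS]mulr1; apply: ler_wpM2l => //.
  exact: ltW.
- move=> x xI gx; apply: hS => //; rewrite ltNge; apply/negP => y1.
  have [F0 f0] := far _ y1.
  by move/eqP: gx; apply; rewrite /g F0 f0 !mul0r addr0.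
Qed.

End oscillation.

(** * Transversality of power sums *)

Section transversality.
Context {R : realType}.
Implicit Types (x z : R) (b : nat -> R) (k q : nat).

(** The sum of |4 - e| (16/25)^e over e >= 1 is about 3.83; what matters is that
    it is smaller than 4. *)
Lemma weighted_geometric_le k :
  \sum_(j < k) `|3 - j%:R| * (16 / 25 : R) ^+ j.+1 <= 39 / 10.
Proof.
pose r : R := 16 / 25.
pose S m := \sum_(j < m) `|3 - j%:R : R| * r ^+ j.+1.
rewrite -/r -/(S k).
(* closed form of the tail, by telescoping *)
have tail m : S (m + 3)%N + r ^+ (m + 4)%N * (m%:R / (1 - r) + r / (1 - r) ^+ 2)
    = S 3 + r ^+ 4 * (r / (1 - r) ^+ 2).
  elim: m => [|m <-]; first by rewrite !add0n mul0r !add0r.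
  have Srec n : S n.+1 = S n + `|3 - n%:R| * r ^+ n.+1 by rewrite /S big_ord_recr.
  have -> : (m.+1 + 3 = (m + 3).+1)%N by [].
  rewrite Srec -addrA; congr (_ + _).
  have -> : `|3 - (m + 3)%N%:R : R| = m%:R.
    by rewrite (_ : 3 - _ = - m%:R) ?normrN ?ger0_norm// natrD; ring.
  have -> : (m.+1 + 4 = (m + 4).+1)%N by [].
  have -> : ((m + 3).+1 = m + 4)%N by rewrite -addnS.
  by rewrite exprS -natr1 /r; field.
have S3 : S 3 + r ^+ 4 * (r / (1 - r) ^+ 2) <= 39 / 10.
  rewrite /S !big_ord_recr big_ord0 /= !subr0.
  have -> : `|3 - 1 : R| = 2 by rewrite ger0_norm; lra.
  have -> : `|3 - 2 : R| = 1 by rewrite ger0_norm; lra.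
  rewrite ger0_norm// /r -[(1 + 1)%R.+1]/3%N -[1.+1]/2%N.
  rewrite (_ : 16 / 25 / _ = 400 / 81); first lra.
  by field.
apply: le_trans S3; rewrite -(tail k).
apply: (@le_trans _ _ (S (k + 3)%N)).
  rewrite /S big_split_ord/= lerDl; apply: sumr_ge0 => i _.
  by rewrite mulr_ge0// exprn_ge0// /r; lra.
rewrite lerDl mulr_ge0 ?exprn_ge0//; first by rewrite /r; lra.
by rewrite addr_ge0 ?divr_ge0 ?exprn_ge0//; rewrite /r; lra.
Qed.

Lemma lower_terms_le k z : 25 / 16 <= z ->
  \sum_(i < k) `|i%:R - k%:R + 4| * z ^+ i <= 39 / 10 * z ^+ k.
Proof.
move=> hz; have z0 : 0 < z by apply: lt_le_trans hz; lra.
rewrite (reindex_inj rev_ord_inj)/=.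
apply: (@le_trans _ _ (\sum_(j < k) (`|3 - j%:R| * (16 / 25) ^+ j.+1) * z ^+ k)).
  apply: ler_sum => j _.
  have -> : (k - j.+1)%:R - k%:R + 4 = 3 - j%:R :> R.
    by rewrite natrB ?ltn_ord// -natr1; ring.
  rewrite -mulrA ler_wpM2l//.
  have -> : z ^+ k = z ^+ j.+1 * z ^+ (k - j.+1) by rewrite -exprD subnKC.
  rewrite mulrA; apply: ler_peMl; first by rewrite exprn_ge0 ?ltW.
  by rewrite -exprMn; apply: exprn_ege1; lra.
by rewrite -mulr_suml ler_wpM2r ?weighted_geometric_le// exprn_ge0 ?ltW.
Qed.

(** With P (z) = sum_(i <= k) b_i z^i, the right-hand side is
    z P' (z) - (k - 4) P (z).  So P and P' are not simultaneously small compared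
    with z^k, and z^(4 - k) P (z) is strictly increasing.  The weight 4 is a
    multiplier chosen to make the sum of the other terms smaller than the term 4
    of index k. *)
Lemma transversality b k z : 25 / 16 <= z -> b k = 1 ->
  (forall i, `|b i| <= 1) ->
  1 / 10 * z ^+ k <= \sum_(i < k.+1) (i%:R - k%:R + 4) * b i * z ^+ i.
Proof.
move=> hz bk b1; rewrite big_ord_recr/= bk subrr add0r mulr1.
have z0 : 0 < z by apply: lt_le_trans hz; lra.
have : `|\sum_(i < k) (i%:R - k%:R + 4) * b i * z ^+ i| <= 39 / 10 * z ^+ k.
  apply: le_trans (lower_terms_le _ hz).
  apply: le_trans (ler_norm_sum _ _ _) _; apply: ler_sum => i _.
  rewrite !normrM -mulrA ler_wpM2l// (ger0_norm (exprn_ge0 _ (ltW z0))).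
  by apply: ler_piMl; [rewrite exprn_ge0 ?ltW|exact: b1].
by rewrite ler_norml => /andP[]; lra.
Qed.

End transversality.

(** * Polynomials in a power of the base *)

Section digit_polynomials.
Context {R : realType}.
Local Notation mu := (@lebesgue_measure R).
Implicit Types (x z : R) (b : nat -> R) (k q : nat).

(** The polynomial sum_(i <= k) b_i z^i at z = x^q, as a polynomial in [x]. *)
Definition digit_poly q b k : {poly R} := \sum_(i < k.+1) b i *: 'X^(q * i).

Lemma digit_polyE q b k x :
  (digit_poly q b k).[x] = \sum_(i < k.+1) b i * (x ^+ q) ^+ i.
Proof.
rewrite /digit_poly horner_sum; apply: eq_bigr => i _.
by rewrite hornerZ hornerXn exprM.
Qed.

Lemma digit_poly_euler q b k :
  'X * (digit_poly q b k)^`() = digit_poly q (fun i => q%:R * i%:R * b i) k.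
Proof.
rewrite /digit_poly raddf_sum mulr_sumr; apply: eq_bigr => i _ /=.
have eulerX n : 'X * ('X^n : {poly R})^`() = n%:R *: 'X^n.
  by case: n => [|n]; rewrite derivXn ?mulr0n ?mulr0 ?scale0r// mulrnAr -exprS scaler_nat.
by rewrite derivZ -scalerAr eulerX scalerA natrM mulrC.
Qed.

Lemma digit_poly_le q b k x (M : R) : 1 <= x ->
  (forall i, (i <= k)%N -> `|b i| <= M) ->
  `|(digit_poly q b k).[x]| <= k.+1%:R * M * (x ^+ q) ^+ k.
Proof.
move=> x1 bM; rewrite digit_polyE.
have M0 : 0 <= M by apply: le_trans (bM 0%N _).
have z1 : 1 <= x ^+ q by rewrite exprn_ege1.
apply: le_trans (ler_norm_sum _ _ _) _.
apply: (@le_trans _ _ (\sum_(i < k.+1) M * (x ^+ q) ^+ k)); last first.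
  by rewrite sumr_const card_ord -mulrA -[_ *+ _]mulr_natl.
apply: ler_sum => i _; have ik : (i <= k)%N by rewrite -ltnS.
rewrite normrM; apply: ler_pM => //; first exact: bM.
have z0 : 0 <= x ^+ q by exact: le_trans z1.
by rewrite ger0_norm; [apply: ler_weXn2l|exact: exprn_ge0].
Qed.

(** The combination that [transversality] bounds from below. *)
Definition lead_weight q b k := digit_poly q (fun i => (i%:R - k%:R + 4) * b i) k.

Lemma digit_poly_transport q b k x :
  x * (digit_poly q b k)^`().[x] =
  q%:R * ((lead_weight q b k).[x] + (k%:R - 4) * (digit_poly q b k).[x]).
Proof.
rewrite -{1}[x]hornerX -hornerM digit_poly_euler !digit_polyE.
rewrite mulr_sumr -big_split/= mulr_sumr; apply: eq_bigr => i _; ring.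
Qed.

End digit_polynomials.

(** * Oscillation over an interval of bases *)

Section parameter_interval.
Context {R : realType}.
Local Notation mu := (@lebesgue_measure R).
Variables (q : nat) (b0 b1 : R).
Hypotheses (q_gt0 : (0 < q)%N) (b0_gt1 : 1 < b0) (b01 : b0 < b1) (b1_le2 : b1 <= 2).
Hypotheses (z0_ge : 25 / 16 <= b0 ^+ q) (z1_le : b1 ^+ q <= 2).
Implicit Types (x z : R) (b : nat -> R) (k : nat).

Let s : R := b0 - 1.
Let r : R := 16 / 25.

Let s_gt0 : 0 < s. Proof. by rewrite /s subr_gt0. Qed.
Let r_gt0 : 0 < r. Proof. by rewrite /r; lra. Qed.
Let Q : R := q%:R.
Let Q_ge1 : 1 <= Q. Proof. by rewrite /Q ler1n. Qed.

Let in_J x : x \in `[b0, b1] ->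
  [/\ 1 < x, x <= 2, s <= x - 1, 25 / 16 <= x ^+ q & x ^+ q <= 2].
Proof.
rewrite in_itv/= => /andP[bx xb]; have hb0 := b0_gt1; have hb1 := b1_le2.
have x1 : 1 < x by exact: lt_le_trans bx.
split; rewrite ?/s; try lra.
- apply: le_trans z0_ge _; apply: lerXn2r => //; rewrite ?nnegrE; by lra.
- apply: le_trans z1_le; apply: lerXn2r => //; rewrite ?nnegrE; by lra.
Qed.

Let pow_bound k z : 25 / 16 <= z -> [/\ 0 < z ^+ k & 1 <= r ^+ k * z ^+ k].
Proof.
move=> hz; split; first by rewrite exprn_gt0//; lra.
by rewrite -exprMn; apply: exprn_ege1; rewrite /r; lra.
Qed.

Section one_polynomial.
Variables (b : nat -> R) (k : nat).
Hypotheses (bk : b k = 1) (b_le1 : forall i, `|b i| <= 1).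

Let p := digit_poly q b k.
Let V := lead_weight q b k.
Let y : {poly R} := ('X - 1%:P) * p.
Let v : {poly R} := Q *: (('X - 1%:P) * V).
Let n : R := k%:R + 4.

Let n_ge4 : 4 <= n. Proof. by rewrite /n lerDr. Qed.

Let weight_le i : (i <= k)%N -> `|i%:R - k%:R + 4 : R| <= n.
Proof.
move=> ik; have : i%:R <= k%:R :> R by rewrite ler_nat.
have : 0 <= i%:R :> R by [].
have : 0 <= k%:R :> R by [].
by rewrite /n ler_norml => *; lra.
Qed.

(* Sizes of the vector field and of its derivative, relative to z^k. *)
Let V_ge x : x \in `[b0, b1] -> 1 / 10 * (x ^+ q) ^+ k <= V.[x].
Proof.
by move=> /in_J[_ _ _ hz _]; rewrite /V /lead_weight digit_polyE; exact: transversality.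
Qed.

Let V_le x : x \in `[b0, b1] -> `|V.[x]| <= n ^+ 2 * (x ^+ q) ^+ k.
Proof.
move=> /in_J[x1 _ _ hz _]; have [w0 _] := pow_bound k hz.
apply: le_trans (digit_poly_le q (M := n) (ltW x1) _) _.
  move=> i ik; rewrite normrM -[leRHS]mulr1; apply: ler_pM => //.
  exact: weight_le.
apply: ler_wpM2r; first exact: ltW.
rewrite expr2; apply: ler_wpM2r; first by have := n_ge4; lra.
by rewrite -natr1 /n lerD2l; lra.
Qed.

Let dV_le x : x \in `[b0, b1] -> `|V^`().[x]| <= Q * n ^+ 3 * (x ^+ q) ^+ k.
Proof.
move=> /in_J[x1 _ _ hz _]; have [w0 _] := pow_bound k hz.
have x0 : 0 < x by lra.
apply: (@le_trans _ _ (`|('X * V^`()).[x]|)).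
  by rewrite hornerM hornerX normrM gtr0_norm// ler_peMl// ltW.
rewrite /V /lead_weight digit_poly_euler.
have k0 : 0 <= k%:R :> R by [].
apply: le_trans (digit_poly_le q (M := Q * n * n) (ltW x1) _) _.
  move=> i ik; rewrite !normrM -/Q (ger0_norm (le_trans ler01 Q_ge1)) -mulrA.
  rewrite -[leRHS]mulrA; apply: ler_wpM2l; first by have := Q_ge1; lra.
  rewrite normr_nat; apply: ler_pM => //.
    have : i%:R <= k%:R :> R by rewrite ler_nat.
    by rewrite /n; lra.
  by rewrite -[leRHS]mulr1; apply: ler_pM => //; exact: weight_le.
apply: ler_wpM2r; first exact: ltW.
have -> : Q * n ^+ 3 = n * (Q * n * n) by ring.
apply: ler_wpM2r; first by rewrite !mulr_ge0//; have := n_ge4; have := Q_ge1; lra.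
by rewrite -natr1 /n lerD2l; lra.
Qed.

Let v_ge x : x \in `[b0, b1] -> Q * s / 10 * (x ^+ q) ^+ k <= v.[x].
Proof.
move=> xJ; have [x1 _ sx hz _] := in_J xJ; have [w0 _] := pow_bound k hz.
rewrite /v hornerZ hornerM hornerXsubC -!mulrA; apply: ler_wpM2l.
  by have := Q_ge1; lra.
rewrite mulrA; apply: (@le_trans _ _ (s * (1 / 10 * (x ^+ q) ^+ k))); first by lra.
apply: ler_pM => //; [exact: ltW|by apply: mulr_ge0; [lra|exact: ltW]|exact: V_ge].
Qed.

Let v_gt0 x : x \in `[b0, b1] -> 0 < v.[x].
Proof.
move=> xJ; apply: lt_le_trans (v_ge xJ); have [_ _ _ hz _] := in_J xJ.
have [w0 _] := pow_bound k hz.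
by rewrite !mulr_gt0// ?invr_gt0// (lt_le_trans ltr01).
Qed.

Let dv_le x : x \in `[b0, b1] ->
  `|v^`().[x]| <= Q * (1 + Q) * n ^+ 3 * (x ^+ q) ^+ k.
Proof.
move=> xJ; have [x1 x2 sx hz _] := in_J xJ; have [w0 _] := pow_bound k hz.
rewrite /v derivZ derivM derivB derivX derivC subr0 mul1r.
rewrite hornerZ hornerD hornerM hornerXsubC.
rewrite normrM (ger0_norm (le_trans ler01 Q_ge1)) -!mulrA.
apply: ler_wpM2l; first exact: le_trans ler01 Q_ge1.
apply: le_trans (ler_normD _ _) _; rewrite normrM.
apply: (@le_trans _ _ (n ^+ 2 * (x ^+ q) ^+ k + Q * n ^+ 3 * (x ^+ q) ^+ k)).
  apply: lerD; first exact: V_le.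
  rewrite -[leRHS]mul1r; apply: ler_pM => //; last exact: dV_le.
  by rewrite ger0_norm; lra.
rewrite -[leLHS]mulrDl (_ : (1 + Q) * _ = (1 + Q) * n ^+ 3 * (x ^+ q) ^+ k); last by ring.
 apply: ler_wpM2r; first exact: ltW.
rewrite mulrDl mul1r lerD2r [n ^+ 3]exprSr.
by have n4 := n_ge4; apply: ler_peMr; [apply: exprn_ge0; lra|lra].
Qed.

Let E : R := 2 / s + Q * n.

(* The factor [x - 1] and the term [(k - 4) p] make [x y'] differ from [v] by a
   multiple of [y]. *)
Let euler_defect x : x \in `[b0, b1] ->
  `|x * y^`().[x] - v.[x]| <= E * `|y.[x]|.
Proof.
move=> xJ; have [x1 x2 sx hz _] := in_J xJ.
have -> : x * y^`().[x] - v.[x] = (x / (x - 1) + Q * (k%:R - 4)) * y.[x].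
  rewrite /v /y derivM derivB derivX derivC subr0 mul1r.
  rewrite hornerZ hornerD !hornerM !hornerXsubC mulrDr.
  have := digit_poly_transport q b k x; rewrite -/p -/V -/Q.
  have -> : x * ((x - 1) * p^`().[x]) = (x - 1) * (x * p^`().[x]) by ring.
  move=> ->; field; lra.
rewrite normrM ler_wpM2r//; apply: le_trans (ler_normD _ _) _; apply: lerD.
  rewrite ger0_norm; last by rewrite divr_ge0; lra.
  have s0 := s_gt0; apply: ler_pM => //; [lra|by rewrite invr_ge0; lra|].
  by rewrite lef_pV2// posrE; lra.
rewrite normrM (ger0_norm (le_trans ler01 Q_ge1)).
apply: ler_wpM2l; first exact: le_trans ler01 Q_ge1.
by have : 0 <= k%:R :> R by []; rewrite /n ler_norml; lra.
Qed.

Let D1 : R := 2 / s + Q + 3 + 20 * (1 + Q) / s.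
Let B : R := 10 / s * D1 * n ^+ 3 * r ^+ k.

Let D1_gt0 : 0 < D1.
Proof.
rewrite /D1; have s0 := s_gt0; have Q1 := Q_ge1.
have : 0 < 2 / s by rewrite divr_gt0.
have : 0 < 20 * (1 + Q) / s by rewrite divr_gt0//; lra.
lra.
Qed.

Let Bv_ge x : x \in `[b0, b1] -> D1 * n ^+ 3 <= B * v.[x].
Proof.
move=> xJ; have [x1 x2 sx hz _] := in_J xJ; have [w0 rw] := pow_bound k hz.
have n30 : 0 <= n ^+ 3 by apply: exprn_ge0; have := n_ge4; lra.
have B0 : 0 <= B.
  rewrite /B; apply: mulr_ge0; last exact: exprn_ge0 (ltW r_gt0).
  by apply: mulr_ge0 => //; rewrite mulr_ge0 ?divr_ge0 ?(ltW s_gt0) ?(ltW D1_gt0).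
apply: le_trans (ler_wpM2l B0 (v_ge xJ)).
have -> : B * (Q * s / 10 * (x ^+ q) ^+ k) =
   D1 * n ^+ 3 * (Q * (r ^+ k * (x ^+ q) ^+ k)).
  by rewrite /B; field; rewrite gt_eqF.
apply: ler_peMr; first by rewrite mulr_ge0// ltW.
by apply: (le_trans rw); apply: ler_peMl => //; exact: (le_trans ler01 rw).
Qed.


Let rho : {poly R} := bump b0 b1.

Let rho_le x : x \in `[b0, b1] ->
  [/\ `|rho.[x]| <= 1, `|(rho * 'X).[x]| <= 2 & `|(rho * 'X)^`().[x]| <= 3].
Proof.
move=> xJ; have [x1 x2 _ _ _] := in_J xJ; move: xJ; rewrite in_itv/= => /andP[bx xb].
have hb0 := b0_gt1; have hb1 := b1_le2.
have u0 : 0 <= x - b0 <= 1 by apply/andP; split; lra.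
have t0 : 0 <= b1 - x <= 1 by apply/andP; split; lra.
have rhoE : rho.[x] = (x - b0) * (b1 - x).
  by rewrite /rho /bump hornerM !hornerD !hornerN !hornerX !hornerC.
have r1 : 0 <= rho.[x] <= 1.
  move: u0 t0; rewrite rhoE => /andP[? ?] /andP[? ?].
  by rewrite mulr_ge0//= mulr_ile1.
move: r1 => /andP[r0 r1]; split.
- by rewrite ger0_norm.
- rewrite hornerM hornerX normrM ger0_norm// ger0_norm; last lra.
  by rewrite -[leRHS]mul1r ler_pM//; lra.
- rewrite derivM derivX mulr1 hornerD hornerM hornerX /rho /bump.
  rewrite derivM !derivB !derivX !derivC subr0 sub0r mul1r -/(bump b0 b1) -/rho.
  rewrite !hornerD !hornerM !hornerN !hornerD !hornerN !hornerX !hornerC.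
  move: u0 t0 => /andP[? ?] /andP[? ?].
  by rewrite ler_norml; apply/andP; split; nra.
Qed.

Let hB x : x \in `[b0, b1] -> `|rho.[x]| * E / v.[x] <= B.
Proof.
move=> xJ; rewrite ler_pdivrMr; last exact: v_gt0.
have [r1 _ _] := rho_le xJ.
have n4 := n_ge4; have n30 : 0 <= n ^+ 3 by apply: exprn_ge0; lra.
have E0 : 0 <= E.
  have := Q_ge1; rewrite /E => ?; apply: addr_ge0; last by apply: mulr_ge0; lra.
  by rewrite divr_ge0// ltW.
apply: le_trans (Bv_ge xJ); apply: (@le_trans _ _ E); first by rewrite ler_piMl.
have n3n : n <= n ^+ 3.
  by rewrite exprS ler_peMr ?exprn_ege1//; lra.
have n31 : 1 <= n ^+ 3 by lra.
have q1 := Q_ge1; have s2 : 0 < 2 / s by rewrite divr_gt0.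
have s20 : 0 < 20 * (1 + Q) / s by rewrite divr_gt0//; lra.
rewrite /E /D1; move: (2 / s) s2 (20 * _ / s) s20 => u u0 t t0.
nra.
Qed.

Let hA x : x \in `[b0, b1] ->
  `|((rho * 'X)^`().[x] * v.[x] - (rho * 'X).[x] * v^`().[x]) / v.[x] ^+ 2| <= B.
Proof.
move=> xJ; have vx := v_gt0 xJ.
have [_ r2 r3] := rho_le xJ.
rewrite normrM normfV (ger0_norm (sqr_ge0 _)) ler_pdivrMr ?exprn_gt0//.
have n4 := n_ge4; have n30 : 0 <= n ^+ 3 by apply: exprn_ge0; lra.
have q1 := Q_ge1; have s0 := s_gt0.
rewrite expr2 mulrA.
apply: (@le_trans _ _ (D1 * n ^+ 3 * v.[x])); last first.
  by rewrite ler_wpM2r ?Bv_ge// ltW.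
apply: le_trans (ler_normB _ _) _; rewrite !normrM (gtr0_norm vx).
apply: (@le_trans _ _ (3 * v.[x] + 2 * (Q * (1 + Q) * n ^+ 3 * (x ^+ q) ^+ k))).
  apply: lerD; first by rewrite ler_wpM2r// ltW.
  by rewrite ler_pM// dv_le.
have hv := v_ge xJ.
have -> : 2 * (Q * (1 + Q) * n ^+ 3 * (x ^+ q) ^+ k) =
    20 * (1 + Q) / s * n ^+ 3 * (Q * s / 10 * (x ^+ q) ^+ k).
  by field; rewrite gt_eqF.
have t0 : 0 < 20 * (1 + Q) / s by rewrite divr_gt0//; lra.
have tn : 0 <= 20 * (1 + Q) / s * n ^+ 3 by apply: mulr_ge0 => //; exact: ltW.
apply: (@le_trans _ _ ((3 + 20 * (1 + Q) / s) * n ^+ 3 * v.[x])).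
  rewrite [in leRHS]mulrDl mulrDl; apply: lerD; last exact: ler_wpM2l.
  rewrite ler_wpM2r ?(ltW vx)//; have : 1 <= n ^+ 3 by apply: exprn_ege1; lra.
  by lra.
rewrite ler_wpM2r ?(ltW vx)// ler_wpM2r// /D1.
have s2 : 0 < 2 / s by rewrite divr_gt0.
lra.
Qed.


(* z^(4 - k) p, which is increasing with a slope bounded below: this bounds the
   diameter of the set where [y] is small. *)
Let F x : R := p.[x] * (('X^(q * 4)).[x] * (('X^(q * k)).[x])^-1).

Let F_slope x x' : x \in `[b0, b1] -> x' \in `[b0, b1] -> x <= x' ->
  (x' - x) / 20 <= F x' - F x.
Proof.
move=> xJ xJ' xx'.
pose dF t := t^-1 * ((t ^+ q) ^+ 4 / (t ^+ q) ^+ k) * (Q * V.[t]).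
have sub t : t \in `[x, x'] -> t \in `[b0, b1].
  move: xJ xJ'; rewrite !in_itv/= => /andP[? ?] /andP[? ?] /andP[? ?].
  by apply/andP; split; lra.
have D t : t \in `[x, x'] -> is_derive t 1 F (dF t).
  move=> /sub tJ; have [t1 _ _ hz _] := in_J tJ; have t0 : 0 < t by lra.
  have tk : ('X^(q * k) : {poly R}).[t] != 0.
    by rewrite hornerXn expf_neq0// gt_eqF.
  have D3 := is_deriveM (is_derive_poly p t)
    (is_deriveM (is_derive_poly ('X^(q * 4)) t) (is_derive_horner_inv tk)).
  apply: is_derive_eq D3 _; rewrite /GRing.scale/= /dF.
  have T := digit_poly_transport q b k t; rewrite -/p -/V -/Q in T.
  have -> : Q * V.[t] = t * p^`().[t] - Q * (k%:R - 4) * p.[t].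
    by rewrite T; ring.
  have eulerX m : ('X^m : {poly R})^`().[t] = t^-1 * (m%:R * t ^+ m).
    rewrite derivXn; case: m => [|m]; first by rewrite mulr0n horner0 mul0r mulr0.
    by rewrite -mulr_natl hornerM hornerXn hornerMn hornerC exprS; field; rewrite gt_eqF.
  rewrite !fctE !eulerX !hornerXn !natrM -/Q !exprM.
  have w0 : (t ^+ q) ^+ k != 0 by rewrite !expf_neq0// gt_eqF.
  by move: ((t ^+ q) ^+ 4) ((t ^+ q) ^+ k) w0 => w' w w0; field; rewrite w0 gt_eqF.
have cF : {within `[x, x'], continuous F}.
  by apply: derivable_within_continuous => t /D[].
have [t tI ->] := MVT_segment xx' (fun t tI => D t (subset_itv_oo_cc tI)) cF.
rewrite mulrC ler_wpM2r ?subr_ge0//.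
have tJ := sub _ tI; have [t1 t2 _ hz _] := in_J tJ; have [w0 _] := pow_bound k hz.
rewrite /dF.
have t2' : 2^-1 <= t^-1 by rewrite lef_pV2 ?posrE; lra.
have z4 : 1 <= (t ^+ q) ^+ 4 by apply: exprn_ege1; lra.
have QV : 1 / 10 * (t ^+ q) ^+ k <= Q * V.[t].
  apply: le_trans (V_ge tJ) _; apply: ler_peMl; last exact: Q_ge1.
  by apply: le_trans (V_ge tJ); apply: mulr_ge0; [lra|exact: ltW].
apply: (@le_trans _ _ (2^-1 * (1 / (t ^+ q) ^+ k) * (1 / 10 * (t ^+ q) ^+ k))).
  by rewrite le_eqVlt; apply/orP; left; apply/eqP; field; rewrite gt_eqF.
have w1 : 0 <= ((t ^+ q) ^+ k)^-1 by rewrite invr_ge0 ltW.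
apply: ler_pM => //.
- by apply: mulr_ge0; [lra|rewrite mul1r; exact: w1].
- by apply: mulr_ge0; [lra|exact: ltW].
- apply: ler_pM => //; [by rewrite mul1r|].
  exact: ler_wpM2r.
Qed.

Let F_le x : x \in `[b0, b1] -> `|y.[x]| < 1 -> `|F x| <= 16 / s * r ^+ k.
Proof.
move=> xJ y1; have [x1 x2 sx hz z2] := in_J xJ; have [w0 rw] := pow_bound k hz.
have s0 := s_gt0.
have pE : `|p.[x]| <= s^-1.
  move: y1; rewrite /y hornerM hornerXsubC normrM ger0_norm; last lra.
  move=> /ltW y1; rewrite -[leRHS]mul1r ler_pdivlMr// mulrC; apply: le_trans y1.
  exact: ler_wpM2r.
have z40 : 0 <= (x ^+ q) ^+ 4 by apply: exprn_ge0; lra.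
have -> : 16 / s * r ^+ k = s^-1 * (16 * r ^+ k) by ring.
rewrite /F !hornerXn !exprM normrM; apply: ler_pM => //.
rewrite normrM ger0_norm// normfV (gtr0_norm w0); apply: ler_pM => //.
- by rewrite invr_ge0 ltW.
- have -> : (16 : R) = 2 ^+ 4 by rewrite -natrX.
  by apply: lerXn2r => //; rewrite nnegrE; lra.
- by rewrite -[leLHS]mul1r ler_pdivrMr.
Qed.

Lemma digit_poly_integral_le_explicit (a : R) : 0 <= a <= 1 ->
  `| \int[mu]_(x in `[b0, b1])
      ((bump b0 b1).[x] * autocorr ramp a ((x - 1) * (digit_poly q b k).[x])) |
  <= 64 * (10 / s * D1) * (640 / s) * n ^+ 3 * r ^+ (2 * k).
Proof.
move=> a01.
pose d := 640 / s * r ^+ k.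
have d0 : 0 <= d.
  apply: mulr_ge0; last by apply: exprn_ge0; exact: ltW.
  by apply: divr_ge0; [exact: ler0n|exact: ltW].
have B0 : 0 <= B.
  have b0J : b0 \in `[b0, b1] by rewrite in_itv/= lexx ltW.
  by apply: le_trans (hA b0J).
have E0 : 0 <= E.
  have := Q_ge1; have := n_ge4; rewrite /E => ? ?.
  by apply: addr_ge0; [rewrite divr_ge0// ltW|apply: mulr_ge0; lra].
have [c hc] : exists c, forall x, x \in `[b0, b1] -> `|y.[x]| < 1 -> `|x - c| <= d.
  have [[c [cJ yc]]|no] := pselect (exists c, c \in `[b0, b1] /\ `|y.[c]| < 1).
    exists c => x xJ yx; have Fx := F_le xJ yx; have Fc := F_le cJ yc.
    have dE : d = 20 * (16 / s * r ^+ k + 16 / s * r ^+ k) by rewrite /d; field; rewrite gt_eqF.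
    move: Fx Fc; rewrite dE !ler_norml => /andP[? ?] /andP[? ?].
    have [cx|/ltW xc] := leP c x.
      by have := F_slope cJ xJ cx; lra.
    by have := F_slope xJ cJ xc; lra.
  by exists 0 => x xJ yx; exfalso; apply: no; exists x.
have -> : 64 * (10 / s * D1) * (640 / s) * n ^+ 3 * r ^+ (2 * k) = 4 * 16 * B * d.
  by rewrite /B /d mul2n -addnn exprD; field; rewrite gt_eqF.
have yE x : (x - 1) * (digit_poly q b k).[x] = y.[x].
  by rewrite /y hornerM hornerXsubC.
under eq_Rintegral do rewrite yE.
apply: (@oscillatory_integral_le R b0 b1 (autocorr ramp2 a) (autocorr ramp a) 16 y v E B c d).
- exact: b01.
- exact: ler0n.
- exact: E0.
- exact: d0.
- exact: B0.
- by move=> t; exact: is_derive_autocorr.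
- exact: autocorr_ramp_continuous.
- by move=> t; exact: autocorr_ramp2_bound.
- by move=> t; exact: autocorr_ramp_bound.
- by move=> t t1; have [? ?] := autocorr_ramp_far a01 t1.
- exact: v_gt0.
- exact: euler_defect.
- exact: hB.
- exact: hA.
- exact: hc.
Qed.

End one_polynomial.
(** One factor (16/25)^k comes from the measure of the set of bases for which the
    point lies in the support of the autocorrelation, the other from the
    integration by parts. *)
Lemma digit_poly_integral_le : exists2 C : R, 0 <= C &
  forall b k (a : R), b k = 1 -> (forall i, `|b i| <= 1) -> 0 <= a <= 1 ->
  `| \int[mu]_(x in `[b0, b1])
      ((bump b0 b1).[x] * autocorr ramp a ((x - 1) * (digit_poly q b k).[x])) |
  <= C * (k%:R + 4) ^+ 3 * (16 / 25) ^+ (2 * k).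
Proof.
exists (64 * (10 / s * (2 / s + Q + 3 + 20 * (1 + Q) / s)) * (640 / s)).
  have s0 := s_gt0; have Q1 := Q_ge1.
  have p10 : 0 <= 10 / s by apply: divr_ge0; [exact: ler0n|exact: ltW].
  have p2 : 0 <= 2 / s by apply: divr_ge0; [exact: ler0n|exact: ltW].
  have p640 : 0 <= 640 / s by apply: divr_ge0; [exact: ler0n|exact: ltW].
  have p20 : 0 <= 20 * (1 + Q) / s by apply: divr_ge0; [lra|exact: ltW].
  apply: mulr_ge0 p640; apply: mulr_ge0; first exact: ler0n.
  by apply: mulr_ge0 p10 _; lra.
by move=> b k a bk b_le1 a01; exact: digit_poly_integral_le_explicit.
Qed.

End parameter_interval.

(** * Averages over differences of digits *)

Section difference_averages.
Context {R : realType}.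
Implicit Types (d x y : R) (ds : seq R) (psi : R -> R).

(** Mean of [psi] at [y + d (e - e')], for independent fair digits e and e'. *)
Definition davg d psi y : R := psi y / 2 + (psi (y + d) + psi (y - d)) / 4.

Definition davgs ds psi : R -> R := foldr davg psi ds.

Definition subset_sums ds : seq R :=
  foldr (fun d S => S ++ [seq s + d | s <- S]) [:: 0] ds.

(** Positive definiteness, without symmetry. *)
Definition posdef psi := forall l : seq (R * R),
  0 <= \sum_(t <- l) \sum_(u <- l) t.1 * u.1 * psi (t.2 - u.2).

Fixpoint powers x n : seq R := if n is m.+1 then x ^+ m :: powers x m else [::].

Lemma subset_sums_cons d ds :
  subset_sums (d :: ds) = subset_sums ds ++ [seq s + d | s <- subset_sums ds].
Proof. by []. Qed.

Lemma davgs_cons d ds psi : davgs (d :: ds) psi = davg d (davgs ds psi).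
Proof. by []. Qed.

Lemma size_subset_sums ds : size (subset_sums ds) = (2 ^ size ds)%N.
Proof.
by elim: ds => //= d ds IH; rewrite size_cat size_map IH addnn -mul2n -expnS.
Qed.

Lemma davgsE ds psi y : davgs ds psi y = 4 ^- size ds *
  \sum_(s <- subset_sums ds) \sum_(u <- subset_sums ds) psi (y + s - u).
Proof.
elim: ds y => [|d ds IH] y.
  by rewrite /= expr0 invr1 mul1r !big_seq1 addr0 subr0.
have S2 (F : R -> R) : \sum_(s <- subset_sums (d :: ds)) F s =
    \sum_(s <- subset_sums ds) (F s + F (s + d)).
  by rewrite subset_sums_cons big_cat big_map big_split.
rewrite davgs_cons /davg !IH.
have -> : \sum_(s <- subset_sums (d :: ds)) \sum_(u <- subset_sums (d :: ds))
      psi (y + s - u) =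
    \sum_(s <- subset_sums ds) \sum_(u <- subset_sums ds)
      (psi (y + s - u) * 2 + (psi (y + d + s - u) + psi (y - d + s - u))).
  rewrite S2; apply: eq_bigr => s _; rewrite !S2 -big_split/=; apply: eq_bigr => u _.
  have -> : y + (s + d) - (u + d) = y + s - u by ring.
  have -> : y + s - (u + d) = y - d + s - u by ring.
  have -> : y + (s + d) - u = y + d + s - u by ring.
  by ring.
pose G c := \sum_(s <- subset_sums ds) \sum_(u <- subset_sums ds) psi (y + c + s - u).
have -> : \sum_(s <- subset_sums ds) \sum_(u <- subset_sums ds)
      (psi (y + s - u) * 2 + (psi (y + d + s - u) + psi (y - d + s - u))) =
    G 0 * 2 + (G d + G (- d)).
  rewrite /G addr0; under eq_bigr do rewrite !big_split/= -mulr_suml.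
  by rewrite !big_split/= -mulr_suml.
rewrite -/(G d) -/(G (- d)) (_ : \sum_(s <- _) _ = G 0) ?/G ?addr0// exprS invfM.
by field; rewrite expf_neq0.
Qed.

Lemma davgC d e psi : davg d (davg e psi) = davg e (davg d psi).
Proof.
apply/funext => y; rewrite /davg (addrAC y e d) (addrAC y e (- d)).
by rewrite (addrAC y (- e) d) (addrAC y (- e) (- d)); field.
Qed.

Lemma davgs_davg d ds psi : davgs ds (davg d psi) = davg d (davgs ds psi).
Proof.
elim: ds => [//|e ds IH]; rewrite !davgs_cons IH; exact: davgC.
Qed.

Lemma davgs_cat ds es psi : davgs (ds ++ es) psi = davgs ds (davgs es psi).
Proof. by rewrite /davgs foldr_cat. Qed.

Lemma davg_even d psi : (forall y, psi (- y) = psi y) ->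
  forall y, davg d psi (- y) = davg d psi y.
Proof.
move=> ev y; rewrite /davg ev.
have -> : - y + d = - (y - d) by ring.
have -> : - y - d = - (y + d) by ring.
by rewrite !ev [psi (y - d) + _]addrC.
Qed.

Lemma davgs_even ds psi : (forall y, psi (- y) = psi y) ->
  forall y, davgs ds psi (- y) = davgs ds psi y.
Proof. by move=> ev; elim: ds => [//|d ds IH]; exact: davg_even. Qed.

Lemma posdef_davgs_ge0 ds psi : posdef psi -> 0 <= davgs ds psi 0.
Proof.
move=> pd; rewrite davgsE mulr_ge0 ?invr_ge0 ?exprn_ge0//.
have := pd [seq (1, s) | s <- subset_sums ds].
rewrite big_map; under eq_bigr do (rewrite big_map; under eq_bigr do rewrite !mul1r).
by under [X in _ -> 0 <= X]eq_bigr do under eq_bigr do rewrite add0r.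
Qed.

(** Averaging over one more digit does not increase the value at 0.  This is the
    contraction of the L^2 norm under averages of translates, read on the
    autocorrelation: test positive definiteness on the difference between the
    family of subset sums and its translate by [d]. *)
Lemma posdef_davgs_cons d ds psi : posdef psi ->
  davgs (d :: ds) psi 0 <= davgs ds psi 0.
Proof.
move=> pd; rewrite davgs_cons /davg add0r sub0r.
suff : 0 <= 2 * davgs ds psi 0 - davgs ds psi d - davgs ds psi (- d) by lra.
set S := subset_sums ds.
have := pd ([seq (1, s) | s <- S] ++ [seq (- 1, s + d) | s <- S]).
rewrite big_cat/= !big_map.
under eq_bigr do rewrite big_cat/= !big_map/=.
under [X in 0 <= _ + X]eq_bigr do rewrite big_cat/= !big_map/=.
rewrite !big_split/= !davgsE -/S => H.
suff <- : 4 ^- size ds * (\sum_(i <- S) \sum_(j <- S) 1 * 1 * psi (i - j) +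
      \sum_(i <- S) \sum_(j <- S) 1 * -1 * psi (i - (j + d)) +
      (\sum_(i <- S) \sum_(j <- S) -1 * 1 * psi (i + d - j) +
       \sum_(i <- S) \sum_(j <- S) -1 * -1 * psi (i + d - (j + d)))) =
   2 * (4 ^- size ds * \sum_(s <- S) \sum_(u <- S) psi (0 + s - u)) -
   4 ^- size ds * \sum_(s <- S) \sum_(u <- S) psi (d + s - u) -
   4 ^- size ds * \sum_(s <- S) \sum_(u <- S) psi (- d + s - u).
  by rewrite mulr_ge0 ?invr_ge0 ?exprn_ge0.
have E0 c f g : (forall i j : R, f i j = g i j) ->
    \sum_(i <- S) \sum_(j <- S) c * psi (f i j) = c * \sum_(i <- S) \sum_(j <- S) psi (g i j).
  move=> fg; rewrite mulr_sumr; apply: eq_bigr => i _.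
  by rewrite mulr_sumr; apply: eq_bigr => j _; rewrite fg.
rewrite (E0 _ _ (fun s u => 0 + s - u)); last by move=> *; ring.
rewrite (E0 _ _ (fun s u => - d + s - u)); last by move=> *; ring.
rewrite (E0 _ _ (fun s u => d + s - u)); last by move=> *; ring.
rewrite (E0 _ _ (fun s u => 0 + s - u)); last by move=> *; ring.
by ring.
Qed.

Lemma posdef_davgs_le ds es psi : posdef psi ->
  davgs (ds ++ es) psi 0 <= davgs es psi 0.
Proof.
move=> pd; elim: ds => [//|d ds IH]; apply: le_trans IH.
exact: posdef_davgs_cons.
Qed.

(** The digits whose index is a multiple of [q] can be averaged first, because
    averaging operators commute; [m] is [n / q] rounded up. *)
Lemma davgs_powers_split x q n psi : (0 < q)%N ->
  exists m ds, (n <= q * m < n + q)%N /\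
    davgs (powers x n) psi = davgs (ds ++ powers (x ^+ q) m) psi.
Proof.
move=> q0; elim: n => [|n [m [ds [nm IH]]]].
  by exists 0%N, [::]; split => //; lia.
have [nE|nqm] := eqVneq n (q * m)%N.
  exists m.+1, ds; split; first by lia.
  rewrite davgs_cat [powers x _]/= [powers _ m.+1]/= !davgs_cons IH davgs_cat.
  by rewrite -davgs_davg nE exprM.
exists m, (x ^+ n :: ds); split; first by lia.
by rewrite cat_cons [powers x _]/= !davgs_cons IH.
Qed.

Lemma davgs_powers_le x q n psi : (0 < q)%N -> posdef psi ->
  exists2 m, (n <= q * m < n + q)%N &
    davgs (powers x n) psi 0 <= davgs (powers (x ^+ q) m) psi 0.
Proof.
move=> q0 pd; have [m [ds [nm ->]]] := davgs_powers_split x n psi q0.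
by exists m => //; exact: posdef_davgs_le.
Qed.

End difference_averages.

(** * Square norms of sums of centred intervals *)

Section boxes.
Context {R : realType}.
Local Notation mu := (@lebesgue_measure R).
Implicit Types (x lo hi a c : R) (f g : R -> R).

Definition box lo hi x : R := (lo <= x <= hi)%R%:R.

Lemma boxE lo hi : box lo hi = \1_`[lo, hi].
Proof.
by apply/funext => x; rewrite /box indicE; congr (_%:R); rewrite mem_setE in_itv.
Qed.

Lemma boxM lo hi lo' hi' x :
  box lo hi x * box lo' hi' x = box (Num.max lo lo') (Num.min hi hi') x.
Proof.
by rewrite /box -natrM mulnb ge_max le_min andbACA.
Qed.

(** Integrability and value of the integral together, so that both are obtained
    by one traversal of a linear combination. *)
Definition has_integral f (I : R) :=
  mu.-integrable setT (EFin \o f) /\ (\int[mu]_x (f x)%:E = I%:E)%E.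

Lemma eq_has_integral f g I J : (forall x, f x = g x) -> I = J ->
  has_integral f I -> has_integral g J.
Proof. by move=> /funext -> ->. Qed.

Lemma has_integral_box lo hi : has_integral (box lo hi) (ramp (hi - lo)).
Proof.
rewrite boxE; split; first exact: integrable_indic_itv.
rewrite integral_indic// setIT.
apply: etrans (lebesgue_measure_itv _) _; rewrite /= lte_fin /ramp.
case: ifPn => [lh|]; first by rewrite -EFinB; congr (_%:E); apply/esym/max_idPl; rewrite subr_ge0 ltW.
by rewrite -leNgt => lh; congr (_%:E); apply/esym/max_idPr; rewrite subr_le0.
Qed.

Lemma has_integralZ c f I : has_integral f I ->
  has_integral (fun x => c * f x) (c * I).
Proof.
move=> [fi fI]; split.
  by have := integrableZl measurableT c fi; apply: eq_integrable.
under eq_integral do rewrite EFinM.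
by rewrite integralZl// fI.
Qed.

Lemma has_integralD f g I J : has_integral f I -> has_integral g J ->
  has_integral (fun x => f x + g x) (I + J).
Proof.
move=> [fi fI] [gi gJ]; split.
  by have := integrableD measurableT fi gi; apply: eq_integrable.
under eq_integral do rewrite EFinD.
by rewrite integralD// fI gJ.
Qed.

Lemma has_integral_sum (T : Type) (s : seq T) (f : T -> R -> R) (I : T -> R) :
  (forall i, has_integral (f i) (I i)) ->
  has_integral (fun x => \sum_(i <- s) f i x) (\sum_(i <- s) I i).
Proof.
move=> fI; elim: s => [|i s IH].
  split; last by under eq_integral do rewrite big_nil; rewrite integral0 big_nil.
  have := integrable0 mu (@setT R); apply: eq_integrable => // x _.
  by rewrite /= big_nil.
rewrite big_cons (_ : (fun x => _) = (fun x => f i x + \sum_(j <- s) f j x)).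
  exact: has_integralD.
by apply/funext => x; rewrite big_cons.
Qed.

Lemma ramp_overlap s c s' c' : 0 <= c -> 0 <= c' ->
  ramp (Num.min (s + c) (s' + c') - Num.max s s') = overlap ramp c c' (s - s').
Proof.
move=> c0 c0'; rewrite /overlap /ramp /Num.max /Num.min.
by do !case: ifPn; rewrite -?leNgt; move=> *; lra.
Qed.

Lemma rampZ (c y : R) : 0 <= c -> ramp (c * y) = c * ramp y.
Proof. by move=> c0; rewrite /ramp maxr_pMr// mulr0. Qed.

(** 1_[0, a] - a 1_[0, 1], translated by [s] and then dilated by [lam]. *)
Definition centred_box (lam a : R) (s x : R) : R :=
  box (lam * s) (lam * (s + a)) x - a * box (lam * s) (lam * (s + 1)) x.

Lemma has_integral_box2 lam s c s' c' : 0 < lam -> 0 <= c -> 0 <= c' ->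
  has_integral (fun x => box (lam * s) (lam * (s + c)) x *
                         box (lam * s') (lam * (s' + c')) x)
               (lam * overlap ramp c c' (s - s')).
Proof.
move=> l0 c0 c0'; under eq_fun do rewrite boxM.
rewrite -maxr_pMr ?(ltW l0)// -minr_pMr ?(ltW l0)//.
have := has_integral_box (lam * Num.max s s') (lam * Num.min (s + c) (s' + c')).
by rewrite -mulrBr rampZ ?(ltW l0)// ramp_overlap.
Qed.

Lemma has_integral_centred_box2 lam a s s' : 0 < lam -> 0 <= a ->
  has_integral (fun x => centred_box lam a s x * centred_box lam a s' x)
               (lam * autocorr ramp a (s - s')).
Proof.
move=> l0 a0.
have H c c' := @has_integral_box2 lam s c s' c' l0.
have K := has_integralD (has_integralD (has_integralD (H a a a0 a0)
  (has_integralZ (- a) (H a 1 a0 ler01))) (has_integralZ (- a) (H 1 a ler01 a0)))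
  (has_integralZ (a ^+ 2) (H 1 1 ler01 ler01)).
apply: eq_has_integral K => [x|]; first by rewrite /centred_box; ring.
by rewrite /autocorr; ring.
Qed.

Lemma has_integral_sqr_sum lam a (l : seq (R * R)) : 0 < lam -> 0 <= a ->
  has_integral (fun x => (\sum_(t <- l) t.1 * centred_box lam a t.2 x) ^+ 2)
    (lam * \sum_(t <- l) \sum_(u <- l) t.1 * u.1 * autocorr ramp a (t.2 - u.2)).
Proof.
move=> l0 a0.
have -> : (fun x => (\sum_(t <- l) t.1 * centred_box lam a t.2 x) ^+ 2) =
  (fun x => \sum_(t <- l) \sum_(u <- l) t.1 * u.1 *
     (centred_box lam a t.2 x * centred_box lam a u.2 x)).
  apply/funext => x; rewrite expr2 mulr_suml; apply: eq_bigr => t _.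
  by rewrite mulr_sumr; apply: eq_bigr => u _; ring.
rewrite mulr_sumr; apply: has_integral_sum => t.
rewrite mulr_sumr; apply: has_integral_sum => u.
by rewrite mulrCA; apply: has_integralZ; exact: has_integral_centred_box2.
Qed.

(** The quadratic form is the integral of a square. *)
Lemma posdef_autocorr a c : 0 <= a ->
  posdef (fun y => autocorr ramp a (c * y)).
Proof.
move=> a0 l.
have [_] := has_integral_sqr_sum [seq (t.1, c * t.2) | t <- l] ltr01 a0.
rewrite mul1r big_map; under eq_bigr do rewrite big_map/=.
move=> H; rewrite -lee_fin.
under eq_bigr do under eq_bigr do rewrite mulrBr.
rewrite -H; apply: integral_ge0 => x _; rewrite lee_fin; exact: sqr_ge0.
Qed.

End boxes.

(** * Mean energy over an interval of bases *)

Section energy_decay.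
Context {R : realType}.
Local Notation mu := (@lebesgue_measure R).
Variables (q : nat) (b0 b1 : R).
Hypotheses (q_gt0 : (0 < q)%N) (b0_gt1 : 1 < b0) (b01 : b0 < b1) (b1_le2 : b1 <= 2).
Hypotheses (z0_ge : 25 / 16 <= b0 ^+ q) (z1_le : b1 ^+ q <= 2).
Variable a : R.
Hypothesis a01 : 0 <= a <= 1.
Implicit Types (x : R) (b : nat -> R) (k j m : nat).

(* The intervals have length proportional to 1 / (x - 1); here they are rescaled
   to length 1. *)
Let psi x : R -> R := fun y => autocorr ramp a ((x - 1) * y).

Lemma davgs_powers_continuous j (P : R -> R) : continuous P ->
  continuous (fun x => davgs (powers (x ^+ q) j) (psi x) (P x)).
Proof.
elim: j P => [|j IH] P cP.
  move=> x; apply: (@continuous_comp _ _ _ (fun x => (x - 1) * P x) (autocorr ramp a)).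
    by apply: cvgM; [apply: cvgB; [exact: cvg_id|exact: cvg_cst]|exact: cP].
  exact: autocorr_ramp_continuous.
have cz : continuous (fun x : R => (x ^+ q) ^+ j).
  by under eq_fun do rewrite -exprM; exact: exprn_continuous.
move=> x; rewrite /= -/(davgs _ _) /davg.
apply: cvgD; apply: cvgMl; first exact: IH.
by apply: cvgD; [apply: (IH (fun x => P x + (x ^+ q) ^+ j))|
  apply: (IH (fun x => P x - (x ^+ q) ^+ j))] => t;
  [apply: cvgD|apply: cvgB]; [exact: cP|exact: cz|exact: cP|exact: cz].
Qed.

Definition energy m x : R := davgs (powers (x ^+ q) m) (psi x) 0.

Lemma energy_continuous m : continuous (energy m).
Proof.
exact: (@davgs_powers_continuous m (cst 0) (fun x => @cst_continuous _ _ 0 x)).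
Qed.

Lemma energy_ge0 m x : 0 <= energy m x.
Proof.
apply: posdef_davgs_ge0; apply: posdef_autocorr.
by case/andP: a01.
Qed.

Let rho : {poly R} := bump b0 b1.
Local Notation weighted f := (\int[mu]_(x in `[b0, b1]) (rho.[x] * f x)).

Let weighted_integrable f : continuous f ->
  mu.-integrable `[b0, b1] (EFin \o (fun x => rho.[x] * f x)).
Proof.
move=> cf; apply: continuous_at_itv_integrable => x _.
by apply: cvgM; [exact: continuous_horner|exact: cf].
Qed.

Let weightedD f g : continuous f -> continuous g ->
  weighted (fun x => f x + g x) = weighted f + weighted g.
Proof.
move=> cf cg; rewrite -RintegralD//; [|exact: weighted_integrable..].
by apply: eq_Rintegral => x _; rewrite mulrDr.
Qed.

Let weightedZ (c : R) f : continuous f ->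
  weighted (fun x => c * f x) = c * weighted f.
Proof.
move=> cf; rewrite -RintegralZl//; last exact: weighted_integrable.
by apply: eq_Rintegral => x _; rewrite mulrCA.
Qed.

Let digit_set b j (e : R) i : R := if i == j then e else b i.

Let digit_poly_set b k j e x : (j < k)%N -> b j = 0 ->
  (digit_poly q (digit_set b j e) k).[x] = (digit_poly q b k).[x] + e * (x ^+ q) ^+ j.
Proof.
move=> jk bj; have jk' : (j < k.+1)%N by lia.
rewrite !digit_polyE (bigD1 (Ordinal jk'))//= [in RHS](bigD1 (Ordinal jk'))//=.
rewrite /digit_set eqxx bj mul0r add0r addrC; congr (_ + _).
by apply: eq_bigr => i ij; rewrite ifN.
Qed.

(** The oscillation bound only depends on the degree and on the size of the
    coefficients, so it survives averaging over the [j] lowest digits. *)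
Lemma averaged_integral_le : exists2 C : R, 0 <= C &
  forall j b k, (j <= k)%N -> b k = 1 -> (forall i, `|b i| <= 1) ->
    (forall i, (i < j)%N -> b i = 0) ->
  `| weighted (fun x => davgs (powers (x ^+ q) j) (psi x) (digit_poly q b k).[x]) |
  <= C * (k%:R + 4) ^+ 3 * (16 / 25) ^+ (2 * k).
Proof.
have [C C0 hC] := digit_poly_integral_le q_gt0 b0_gt1 b01 b1_le2 z0_ge z1_le.
exists C => // j; elim: j => [|j IH] b k jk bk ble bz; first exact: hC.
pose g (e : R) x := davgs (powers (x ^+ q) j) (psi x) (digit_poly q (digit_set b j e) k).[x].
have cg e : continuous (g e).
  by apply: davgs_powers_continuous => x; exact: continuous_horner.
have bj : b j = 0 by apply: bz.
have hg e : `|e| <= 1 -> `|weighted (g e)| <= C * (k%:R + 4) ^+ 3 * (16 / 25) ^+ (2 * k).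
  move=> e1; apply: IH; first exact: ltnW.
  - by rewrite /digit_set gtn_eqF.
  - by move=> i; rewrite /digit_set; case: ifP.
  - by move=> i ij; rewrite /digit_set ltn_eqF// bz// ltnW.
have -> : weighted (fun x => davgs (powers (x ^+ q) j.+1) (psi x) (digit_poly q b k).[x])
    = 2^-1 * weighted (g 0) + 4^-1 * (weighted (g 1) + weighted (g (-1))).
  rewrite -weightedD// -!weightedZ//; last by move=> x; apply: cvgD; exact: cg.
  rewrite -weightedD//.
  - apply: eq_Rintegral => x _; congr (_ * _).
    rewrite /= -/(davgs _ _) /davg /g !digit_poly_set// mul0r addr0 mul1r mulN1r.
    by ring.
  - by move=> x; apply: cvgMr; exact: cg.
  - by move=> x; apply: cvgMr; apply: cvgD; exact: cg.
have := hg 0; have := hg 1; have := hg (-1).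
rewrite normrN !normr1 normr0 => /(_ (lexx _)) + /(_ (lexx _)) + /(_ ler01).
move: (weighted (g 0)) (weighted (g 1)) (weighted (g (-1))) => u v w.
by rewrite !ler_norml => /andP[? ?] /andP[? ?] /andP[? ?]; lra.
Qed.

(** Condition on the top digit difference: it vanishes with probability 1/2, and
    otherwise the point is, up to sign, a polynomial with leading term z^m. *)
Lemma energyS m x : energy m.+1 x =
  2^-1 * energy m x + 2^-1 * davgs (powers (x ^+ q) m) (psi x) ((x ^+ q) ^+ m).
Proof.
rewrite /energy /= -/(davgs _ _) /davg add0r sub0r davgs_even; first by field.
by move=> y; rewrite /psi mulrN autocorr_rampN.
Qed.

(* The factor 6/5 is small enough for (16/25)^2 * 6/5 < 123/250 < 1/2. *)
Let cubic_le k : (k%:R + 4) ^+ 3 <= 16 ^+ 3 * (6 / 5) ^+ k :> R.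
Proof.
have k0 i : 0 <= i%:R :> R by exact: ler0n.
apply: (@le_trans _ _ ((k%:R + 16) ^+ 3)).
  by have := k0 k => kk; apply: lerXn2r; rewrite ?nnegrE; lra.
elim: k => [|k IH]; first by rewrite add0r expr0 mulr1.
rewrite [(6 / 5) ^+ _]exprSr [leRHS]mulrA; apply: (@le_trans _ _ ((k%:R + 16) ^+ 3 * (6 / 5))); last first.
  by apply: ler_wpM2r => //; lra.
rewrite -natr1; have := k0 k; move: (k%:R : R) => u u0.
have h : u + 1 + 16 <= 17 / 16 * (u + 16) by lra.
apply: (@le_trans _ _ ((17 / 16 * (u + 16)) ^+ 3)).
  by apply: lerXn2r; rewrite ?nnegrE; lra.
rewrite exprMn mulrC; apply: ler_wpM2l; first by apply: exprn_ge0; lra.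
by rewrite !exprS expr0; lra.
Qed.

(** [energyS] gives u_(m+1) <= u_m / 2 + C' g^m for the integrals u_m, with
    g < 1/2; subtracting the particular solution of ratio g leaves 2^-m. *)
Lemma weighted_energy_le : exists2 A : R, 0 <= A &
  forall m, weighted (energy m) <= A * 2^-1 ^+ m.
Proof.
have [C C0 hC] := averaged_integral_le.
pose g : R := 123 / 250.
have hm m : weighted (energy m.+1) <= 2^-1 * weighted (energy m) + C * 16 ^+ 3 * g ^+ m.
  pose f x := davgs (powers (x ^+ q) m) (psi x) ((x ^+ q) ^+ m).
  have cf : continuous f.
    apply: davgs_powers_continuous.
    by under eq_fun do rewrite -exprM; exact: exprn_continuous.
  have -> : weighted (energy m.+1) = 2^-1 * weighted (energy m) + 2^-1 * weighted f.
    rewrite -!weightedZ//; last exact: energy_continuous.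
    rewrite -weightedD//.
    - by apply: eq_Rintegral => x _; rewrite energyS.
    - by move=> x; apply: cvgMr; exact: energy_continuous.
    - by move=> x; apply: cvgMr; exact: cf.
  rewrite lerD2l.
  have := hC m (fun i => (i == m)%:R) m (leqnn m).
  rewrite eqxx => /(_ erefl).
  have H1 i : `|(i == m)%:R : R| <= 1 by case: eqP; rewrite ?normr1 ?normr0.
  have H2 i : (i < m)%N -> (i == m)%:R = 0 :> R by move=> im; rewrite ltn_eqF.
  move=> /(_ H1 H2).
  have -> : weighted (fun x => davgs (powers (x ^+ q) m) (psi x)
      (digit_poly q (fun i => (i == m)%:R) m).[x]) = weighted f.
    apply: eq_Rintegral => x _; congr (_ * davgs _ _ _).
    rewrite digit_polyE (bigD1 (ord_max))//= eqxx mul1r big1 ?addr0// => i im.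
    by rewrite (_ : (i == m :> nat) = false) ?mul0r//; apply/negbTE.
  rewrite ler_norml => /andP[_ fm].
  have C1 : C * (m%:R + 4) ^+ 3 * (16 / 25) ^+ (2 * m) <= C * 16 ^+ 3 * g ^+ m.
    rewrite -[leLHS]mulrA -[leRHS]mulrA; apply: ler_wpM2l => //; rewrite exprM.
    apply: le_trans (ler_wpM2r _ (cubic_le m)) _; first by rewrite !exprn_ge0; lra.
    rewrite -[leLHS]mulrA; apply: ler_wpM2l; first exact: exprn_ge0.
    rewrite -exprMn.
    apply: lerXn2r; rewrite ?nnegrE /g; lra.
  have C2 : 0 <= C * 16 ^+ 3 * g ^+ m by rewrite !mulr_ge0 ?exprn_ge0// /g; lra.
  by lra.
(* 1/2 - 123/250 = 1/125: [- kap * g ^+ m] solves the recurrence *)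
pose kap : R := C * 16 ^+ 3 / (1 / 125).
have kap0 : 0 <= kap by rewrite divr_ge0 ?mulr_ge0 ?exprn_ge0//; lra.
pose A0 := weighted (energy 0).
have A00 : 0 <= A0.
  apply: Rintegral_ge0 => x /=; rewrite in_itv/= => /andP[x0 x1].
  rewrite mulr_ge0 ?energy_ge0// /rho /bump hornerM !hornerD !hornerN !hornerX !hornerC.
  by rewrite mulr_ge0//; lra.
exists (A0 + kap); first exact: addr_ge0.
move=> m; apply: (@le_trans _ _ ((A0 + kap) * 2^-1 ^+ m - kap * g ^+ m)); last first.
  by rewrite gerBl mulr_ge0// exprn_ge0// /g; lra.
elim: m => [|m IH]; first by rewrite !expr0 !mulr1 addrK.
apply: le_trans (hm m) _; rewrite [2^-1 ^+ _.+1]exprS [g ^+ _.+1]exprS.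
have -> : C * 16 ^+ 3 * g ^+ m = kap * (1 / 125) * g ^+ m.
  by rewrite /kap divfK//; lra.
move: IH; rewrite /g; move: (2^-1 ^+ m) ((123 / 250) ^+ m) => u w.
move: (weighted _) => W IH.
have -> : (A0 + kap) * (2^-1 * u) - kap * (123 / 250 * w) =
   2^-1 * ((A0 + kap) * u - kap * w) + kap * (1 / 125) * w by field.
by rewrite lerD2r ler_wpM2l.
Qed.

End energy_decay.

(** * Almost everywhere summability *)

Section almost_everywhere_summable.
Context {R : realType}.
Local Notation mu := (@lebesgue_measure R).

Lemma ae_imply (P Q : R -> Prop) : (forall x, P x -> Q x) ->
  {ae mu, forall x, P x} -> {ae mu, forall x, Q x}.
Proof. by move=> PQ; apply: (@filterS _ _ (ae_filter_ringOfSetsType mu)). Qed.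

Lemma ae_and (P Q : R -> Prop) : {ae mu, forall x, P x} ->
  {ae mu, forall x, Q x} -> {ae mu, forall x, P x /\ Q x}.
Proof. by move=> P_ Q_; apply: (@filterI _ _ (ae_filter_ringOfSetsType mu)). Qed.

Lemma ae_countable (T : countType) (P : T -> R -> Prop) :
  (forall t, {ae mu, forall x, P t x}) -> {ae mu, forall x, forall t, P t x}.
Proof.
move=> aeP.
have : {ae mu, forall x, forall n, if unpickle n is Some t then P t x else True}.
  apply: ae_foralln => n; case: (unpickle n) => [t|]; first exact: aeP.
  exact: aeW.
by apply: ae_imply => x H t; have := H (pickle t); rewrite pickleK.
Qed.

Lemma nneseries_le_ub (u : nat -> \bar R) (c : \bar R) : (forall n, (0 <= u n)%E) ->
  (forall N, (\sum_(0 <= n < N) u n <= c)%E) -> (\sum_(0 <= n <oo) u n <= c)%E.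
Proof.
move=> u0 uc; apply: lime_le; first exact: is_cvg_nneseries.
exact: nearW.
Qed.

Lemma le_nneseries (u : nat -> \bar R) n : (forall n, (0 <= u n)%E) ->
  (u n <= \sum_(0 <= i <oo) u i)%E.
Proof.
move=> u0; apply: le_trans (nneseries_lim_ge n.+1 _); last by move=> *.
by rewrite big_nat_recr//= leeDr// sume_ge0.
Qed.

Lemma geometric_sum_le (A g : R) N : 0 <= A -> 0 <= g < 1 ->
  \sum_(0 <= n < N) A * g ^+ n <= A / (1 - g).
Proof.
move=> A0 /andP[g0 g1]; have d0 : 0 < 1 - g by lra.
rewrite -mulr_sumr ler_wpM2l// -[leRHS]mul1r ler_pdivlMr//.
have : \sum_(0 <= n < N) g ^+ n * (1 - g) = 1 - g ^+ N.
  elim: N => [|N IH]; first by rewrite big_geq// expr0 subrr.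
  by rewrite big_nat_recr//= IH exprS; ring.
by rewrite mulr_suml => ->; rewrite gerBl exprn_ge0.
Qed.

Lemma ae_summable (D : set (measurableTypeR R)) (f : nat -> R -> R) (A g : R) :
  measurable D -> 0 <= A -> 0 <= g < 1 ->
  (forall n x, D x -> 0 <= f n x) -> (forall n, measurable_fun D (f n)) ->
  (forall n, (\int[mu]_(x in D) (f n x)%:E <= (A * g ^+ n)%:E)%E) ->
  {ae mu, forall x, D x -> (\sum_(0 <= n <oo) (f n x)%:E < +oo)%E}.
Proof.
move=> mD A0 g01 f0 mf fA; have /andP[g0 g1] := g01.
have mF n : measurable_fun D (EFin \o f n) by exact/measurable_EFinP.
have F0 n x : D x -> (0 <= (f n x)%:E)%E by move=> Dx; rewrite lee_fin f0.
have I : mu.-integrable D (fun x => \sum_(0 <= n <oo) (f n x)%:E)%E.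
  apply/integrableP; split.
    have M := @ge0_emeasurable_sum _ _ _ D (fun n x => (f n x)%:E) xpredT.
    by apply: M => [n x Dx _|n _]; [exact: F0|exact: mF].
  under eq_integral => x /[!inE] Dx.
    rewrite gee0_abs; last by apply: nneseries_ge0 => n _ _; exact: F0.
    over.
  rewrite integral_nneseries//; apply: (@le_lt_trans _ _ (A / (1 - g))%:E); last exact: ltry.
  apply: nneseries_le_ub; first by move=> n; apply: integral_ge0 => x; exact: F0.
  move=> N; apply: (@le_trans _ _ (\sum_(0 <= n < N) (A * g ^+ n)%:E)%E).
    exact: lee_sum.
  by rewrite sumEFin lee_fin; exact: geometric_sum_le.
have := integrable_ae mD I.
apply: filterS => x H Dx; have := H Dx.
by rewrite ge0_fin_numE//; apply: nneseries_ge0 => n _ _; exact: F0.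
Qed.

Lemma ae_bounded (D : set (measurableTypeR R)) (f : nat -> R -> R) (A g : R) :
  measurable D -> 0 <= A -> 0 <= g < 1 ->
  (forall n x, D x -> 0 <= f n x) -> (forall n, measurable_fun D (f n)) ->
  (forall n, (\int[mu]_(x in D) (f n x)%:E <= (A * g ^+ n)%:E)%E) ->
  {ae mu, forall x, D x -> exists C : R, forall n, f n x <= C}.
Proof.
move=> mD A0 g01 f0 mf fA.
have := ae_summable mD A0 g01 f0 mf fA.
apply: filterS => x H Dx; exists (fine (\sum_(0 <= n <oo) (f n x)%:E)%E) => n.
rewrite -lee_fin fineK.
  apply: (le_nneseries (u := fun n => (f n x)%:E)) => i.
  by rewrite lee_fin f0.
rewrite ge0_fin_numE ?H//; apply: nneseries_ge0 => i _ _.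
by rewrite lee_fin f0.
Qed.

End almost_everywhere_summable.

Section energy_almost_everywhere.
Context {R : realType}.
Local Notation mu := (@lebesgue_measure R).

(** The weighted energies sum to a function with finite integral; the weight is
    positive in the open interval. *)
Lemma energy_ae_bounded (q : nat) (b0 b1 a tau : R) : (0 < q)%N -> 1 < b0 -> b1 <= 2 ->
  25 / 16 <= b0 ^+ q -> b1 ^+ q <= 2 -> 0 <= a <= 1 -> 0 <= tau < 2 ->
  {ae mu, forall x, b0 < x < b1 ->
    exists C : R, forall m, tau ^+ m * energy q a m x <= C}.
Proof.
move=> q0 hb0 hb1 z0 z1 a01 /andP[t0 t2].
have [b01|b10] := ltP b0 b1; last first.
  by apply: aeW => x /andP[bx xb]; have := lt_trans bx xb; rewrite ltNge b10.
have [A A0 hA] := weighted_energy_le q0 hb0 b01 hb1 z0 z1 a01.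
have bump_ge0 x : x \in `[b0, b1] -> 0 <= (bump b0 b1).[x].
  rewrite in_itv/= => /andP[? ?].
  rewrite /bump hornerM !hornerD !hornerN !hornerX !hornerC.
  by rewrite mulr_ge0//; lra.
pose f m x := tau ^+ m * ((bump b0 b1).[x] * energy q a m x).
have cf m : continuous (f m).
  move=> x; apply: cvgMr; apply: cvgM; first exact: continuous_horner.
  exact: energy_continuous.
have := @ae_bounded R `[b0, b1] f A (tau / 2) _ A0 _ _ _ _.
move=> /(_ (measurable_itv _)).
have g01 : 0 <= tau / 2 < 1 by apply/andP; split; lra.
have f0 n x : x \in `[b0, b1] -> 0 <= f n x.
  move=> xI; apply: mulr_ge0; first exact: exprn_ge0.
  by apply: mulr_ge0; [exact: bump_ge0|exact: energy_ge0].
have mf n : measurable_fun `[b0, b1] (f n).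
  by apply: measurable_funTS; exact: continuous_measurable_fun.
move=> /(_ g01 f0 mf) H.
have {}H : {ae mu, forall x, x \in `[b0, b1] -> exists C : R, forall n, f n x <= C}.
  apply: H => n.
  have If : mu.-integrable `[b0, b1] (EFin \o (fun x => (bump b0 b1).[x] * energy q a n x)).
    apply: continuous_at_itv_integrable => x _; apply: cvgM.
      exact: continuous_horner.
    exact: energy_continuous.
  under eq_integral do rewrite EFinM.
  rewrite integralZl// expr_div_n mulrCA EFinM lee_wpmul2l ?lee_fin ?exprn_ge0//.
  rewrite -[leLHS]fineK; last exact: integrable_fin_num.
  by rewrite lee_fin; have := hA n; rewrite /Rintegral exprVn.
move: H; apply: ae_imply => x H /andP[bx xb].
have [|C hC] := H; first by rewrite in_itv/= !ltW.
have r0 : 0 < (bump b0 b1).[x].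
  rewrite /bump hornerM !hornerD !hornerN !hornerX !hornerC.
  by rewrite mulr_gt0//; lra.
exists (C / (bump b0 b1).[x]) => m.
by rewrite ler_pdivlMr// -mulrA [energy _ _ _ _ * _]mulrC; exact: hC.
Qed.

End energy_almost_everywhere.

(** * Almost every base has decaying energies *)

Section good_parameters.
Context {R : realType}.
Local Notation mu := (@lebesgue_measure R).

Lemma bernoulli_le (t : R) n : 0 <= t -> 1 + n%:R * t <= (1 + t) ^+ n.
Proof.
move=> t0; elim: n => [|n IH]; first by rewrite mul0r addr0 expr0.
rewrite exprS; apply: (@le_trans _ _ ((1 + t) * (1 + n%:R * t))); last first.
  by apply: ler_wpM2l => //; lra.
have n0 : 0 <= n%:R :> R by [].
rewrite -natr1; have : 0 <= n%:R * (t * t) by rewrite !mulr_ge0.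
by move: (n%:R : R) n0 => u u0 H; nra.
Qed.

Lemma exists_expr_gt (x y : R) : 0 <= y -> 1 < x -> exists n, y < x ^+ n.
Proof.
move=> y0 x1; exists (Num.bound (y / (x - 1))).
have t0 : 0 < x - 1 by rewrite subr_gt0.
have := bernoulli_le (Num.bound (y / (x - 1))) (ltW t0).
rewrite addrCA subrr addr0; apply: lt_le_trans.
rewrite ltr_pwDl// -ler_pdivrMr//; apply: ltW.
by apply: archi_boundP; rewrite divr_ge0// ltW.
Qed.

(** Where the assumption x < sqrt 2 is used.  If x^2 <= 25/16 then x <= 5/4, and
    the first power above 25/16 is at most 25/16 * 5/4 = 125/64. *)
Lemma exists_window_power (x : R) : 1 < x -> x ^+ 2 < 2 ->
  exists2 q, (0 < q)%N & 25 / 16 < x ^+ q < 2.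
Proof.
move=> x1 x2; have [lo|hi] := ltP (25 / 16) (x ^+ 2); first by exists 2%N => //; apply/andP.
have h2516 : 0 <= 25 / 16 :> R by lra.
have x54 : x <= 5 / 4.
  rewrite leNgt; apply/negP => h; move: hi; rewrite leNgt => /negP; apply.
  by rewrite expr2; nra.
have [q hq qmin] := ex_minnP (exists_expr_gt h2516 x1).
case: q => [|q] in hq qmin *; first by move: hq; rewrite expr0; lra.
exists q.+1 => //; rewrite hq/= exprS.
have : x ^+ q <= 25 / 16.
  by rewrite leNgt; apply/negP => /qmin; rewrite ltnn.
have : 0 < x ^+ q by rewrite exprn_gt0//; lra.
by move: (x ^+ q) => u *; nra.
Qed.

Lemma exists_rational_window (x lo hi : R) q : 1 < x -> x < 2 -> lo < x ^+ q < hi ->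
  exists b0 b1 : rat, [/\ 1 < ratr b0 :> R, ratr b0 < x, x < ratr b1 :> R & ratr b1 <= 2 :> R]
    /\ lo <= ratr b0 ^+ q /\ ratr b1 ^+ q <= hi.
Proof.
move=> x1 x2 /andP[lx xh].
have cq : (fun t : R => t ^+ q) @ x --> x ^+ q by exact: exprn_continuous.
have N : \forall t \near x, [/\ 1 < t, t < 2, lo < t ^+ q & t ^+ q < hi].
  near=> t; split; near: t.
  - exact: lt_nbhsr.
  - exact: lt_nbhsl.
  - exact: (cq _ (lt_nbhsr lx)).
  - exact: (cq _ (lt_nbhsl xh)).
have [e /= e0 He] := N.
have [b0 /itvP b0I] := @rat_in_itvoo R (x - e) x ltac:(lra).
have [b1 /itvP b1I] := @rat_in_itvoo R x (x + e) ltac:(lra).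
exists b0, b1.
have [|? _ /ltW ? _] := He (ratr b0).
  by rewrite /ball/= ger0_norm ?subr_ge0 ?b0I// ltrBlDr -ltrBlDl b0I.
have [|_ /ltW ? _ /ltW ?] := He (ratr b1).
  by rewrite /ball/= distrC ger0_norm ?subr_ge0 ?b1I// ltrBlDl b1I.
by split; [split; rewrite ?b0I ?b1I|].
Unshelve. all: by end_near. Qed.

(** All that is retained about the base: the energies beat z^m, simultaneously
    for all rational [a]. *)
Definition energy_decays (x : R) := exists q tau, [/\ (0 < q)%N, x ^+ q < tau &
  forall a : rat, 0 <= (ratr a : R) <= 1 ->
    exists C : R, forall m, tau ^+ m * energy q (ratr a) m x <= C].

Lemma ae_energy_decays :
  {ae mu, forall x : R, 1 < x -> x ^+ 2 < 2 -> energy_decays x}.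
Proof.
(* countably many intervals, rates and values of a *)
pose P (t : nat * rat * rat * rat * rat) (x : R) :=
  let '(q, b0, b1, tau, a) := t in
  (0 < q)%N -> 1 < ratr b0 :> R -> ratr b1 <= 2 :> R -> 25 / 16 <= ratr b0 ^+ q :> R ->
  ratr b1 ^+ q <= 2 :> R -> 0 <= (ratr a : R) <= 1 -> 0 <= (ratr tau : R) < 2 ->
  ratr b0 < x < ratr b1 ->
  exists C : R, forall m, ratr tau ^+ m * energy q (ratr a) m x <= C.
have : {ae mu, forall x, forall t, P t x}.
  apply: ae_countable => -[[[[q b0] b1] tau] a].
  have [H|H] := pselect [/\ (0 < q)%N, 1 < ratr b0 :> R, ratr b1 <= 2 :> R,
      25 / 16 <= ratr b0 ^+ q :> R & [/\ ratr b1 ^+ q <= 2 :> R,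
      0 <= (ratr a : R) <= 1 & 0 <= (ratr tau : R) < 2]].
    case: H => ? ? ? ? [? ? ?].
    have := @energy_ae_bounded R q (ratr b0) (ratr b1) (ratr a) (ratr tau).
    do 7 move=> /(_ ltac:(assumption)).
    by apply: ae_imply => x Hx ? ? ? ? ? ? ? /Hx.
  by apply: aeW => x ? ? ? ? ? ? ? _; exfalso; apply: H; split => //; split.
apply: ae_imply => x H x1 x2.
have [q q0 /andP[lo hi]] := exists_window_power x1 x2.
have x22 : x < 2 by nra.
have [b0 [b1 [[h1 h2 h3 h4] [h5 h6]]]] :=
  exists_rational_window x1 x22 (introT andP (conj lo hi)).
have [tau /itvP tI] := rat_in_itvoo hi.
exists q, (ratr tau); split => //; first by rewrite tI.
move=> a a01; apply: (H (q, b0, b1, tau, a)) => //.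
  by rewrite tI ltW// (lt_trans _ (_ : x ^+ q < _)) ?tI// exprn_gt0//; lra.
by rewrite h2 h3.
Qed.

End good_parameters.

(** * Weighted counts of words *)

Section weighted_counts.
Context {R : realType}.
Local Notation mu := (@lebesgue_measure R).
Variable beta : R.
Hypotheses (beta_gt1 : 1 < beta) (beta_lt2 : beta < 2).
Implicit Types (x c a : R) (n m : nat).

Let L : R := (beta - 1)^-1.
Let lam n : R := beta ^- n * L.

Let L_gt0 : 0 < L. Proof. by rewrite invr_gt0 subr_gt0. Qed.
Let beta_gt0 : 0 < beta. Proof. exact: lt_trans beta_gt1. Qed.
Let lam_gt0 n : 0 < lam n.
Proof. by rewrite mulr_gt0// invr_gt0 exprn_gt0. Qed.
Let betaL : beta * L = L + 1.
Proof.
have h : beta - 1 != 0 by rewrite subr_eq0 gt_eqF.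
by rewrite /L; field.
Qed.

(** P^n applied to the indicator of [0, c], see [transferS]; the subset sums of
    1, ..., beta^(n-1) are the translations produced by the words of length n. *)
Definition transfer n c x : R := (beta / 2) ^+ n *
  \sum_(s <- subset_sums (powers beta n)) box 0 c (beta ^+ n * x - s).

Definition discrepancy n a x : R :=
  transfer n (a * L) x - a * transfer n L x.

Lemma transfer0 c x : transfer 0 c x = box 0 c x.
Proof. by rewrite /transfer /= !expr0 !mul1r big_seq1 subr0. Qed.

Lemma transferS n c x :
  transfer n.+1 c x = beta / 2 * (transfer n c (beta * x) + transfer n c (beta * x - 1)).
Proof.
rewrite /transfer /= -/(subset_sums _) big_cat big_map [X in X * _]exprS -mulrA; congr (_ * _).
rewrite -mulrDr; congr (_ * (_ + _)); apply: eq_bigr => s _; congr (box _ _ _).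
- by rewrite exprSr mulrA.
- by rewrite exprSr; ring.
Qed.

Lemma transfer_ge0 n c x : 0 <= transfer n c x.
Proof.
apply: mulr_ge0; first by apply: exprn_ge0; rewrite divr_ge0// ltW.
by apply: sumr_ge0 => s _; rewrite /box.
Qed.

(** A point outside [0, L] never comes back. *)
Lemma transfer_out n x : x \notin `[0, L] -> transfer n L x = 0.
Proof.
elim: n x => [|n IH] x; rewrite in_itv/= => xI.
  by rewrite transfer0 /box (negbTE xI).
rewrite transferS !IH ?addr0 ?mulr0//; rewrite in_itv/= negb_and -!ltNge;
  move: xI; rewrite negb_and -!ltNge => /orP[x0|xL]; apply/orP.
- by left; have := beta_gt1; nra.
- right; have := betaL; have := L_gt0; have := beta_gt1; nra.
- by left; have := beta_gt1; nra.
- right; have := betaL; have := L_gt0; have := beta_gt1; nra.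
Qed.

(* Pulls the interval back from the scale of the orbit to that of [x]. *)
Let scaled_box n a s x :
  box 0 (a * L) (beta ^+ n * x - s) =
  box (lam n * ((beta - 1) * s)) (lam n * ((beta - 1) * s + a)) x.
Proof.
have bn : 0 < beta ^+ n by rewrite exprn_gt0.
have E : lam n * ((beta - 1) * s) = s / beta ^+ n.
  by rewrite /lam /L; field; rewrite !gt_eqF// subr_gt0.
have E' : s / beta ^+ n + lam n * a = (s + a * L) / beta ^+ n.
  by rewrite /lam; field; rewrite gt_eqF.
rewrite mulrDr E E' /box; congr ((_ && _)%:R).
  by rewrite subr_ge0 ler_pdivrMr// mulrC.
by rewrite [RHS]ler_pdivlMr// lerBlDl mulrC.
Qed.

Lemma discrepancyE n a x : discrepancy n a x =
  \sum_(t <- [seq ((beta / 2) ^+ n, (beta - 1) * s) | s <- subset_sums (powers beta n)])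
    t.1 * centred_box (lam n) a t.2 x.
Proof.
rewrite big_map /= -mulr_sumr /discrepancy /transfer mulrCA -mulrBr; congr (_ * _).
rewrite mulr_sumr -sumrB; apply: eq_bigr => s _.
by rewrite /centred_box scaled_box -[L in box 0 L]mul1r scaled_box.
Qed.

Lemma has_integral_transfer n : has_integral (transfer n L) L.
Proof.
have bn : 0 < beta ^+ n by rewrite exprn_gt0.
have H : has_integral (fun x => (beta / 2) ^+ n * \sum_(s <- subset_sums (powers beta n))
    box (lam n * ((beta - 1) * s)) (lam n * ((beta - 1) * s + 1)) x)
    ((beta / 2) ^+ n * \sum_(s <- subset_sums (powers beta n)) lam n).
  apply: has_integralZ; apply: has_integral_sum => s.
  apply: eq_has_integral (has_integral_box _ _) => //.
  by rewrite mulrDr mulr1 addrAC subrr add0r ramp_pos ?ltW.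
have size_powers : size (powers beta n) = n by elim: n {bn H} => //= n ->.
apply: eq_has_integral H => [x|].
  rewrite /transfer; congr (_ * _); apply: eq_bigr => s _.
  by rewrite -[L in box 0 L]mul1r scaled_box.
rewrite big_const_seq count_predT size_subset_sums size_powers iter_addr_0.
rewrite -[lam n *+ _]mulr_natr natrX expr_div_n /lam; field.
by rewrite gt_eqF// expf_neq0.
Qed.

Lemma has_integral_sqr_discrepancy n a : 0 <= a ->
  has_integral (fun x => discrepancy n a x ^+ 2)
    (L * beta ^+ n * davgs (powers beta n) (fun y => autocorr ramp a ((beta - 1) * y)) 0).
Proof.
move=> a0; have bn : 0 < beta ^+ n by rewrite exprn_gt0.
have size_powers : size (powers beta n) = n by elim: n {bn} => //= n ->.
have := has_integral_sqr_sum
  [seq ((beta / 2) ^+ n, (beta - 1) * s) | s <- subset_sums (powers beta n)] (lam_gt0 n) a0.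
apply: eq_has_integral => [x|]; first by rewrite discrepancyE.
rewrite davgsE size_powers big_map.
have -> : \sum_(s <- subset_sums (powers beta n))
      \sum_(u <- [seq ((beta / 2) ^+ n, (beta - 1) * s0) | s0 <- subset_sums (powers beta n)])
        (beta / 2) ^+ n * u.1 * autocorr ramp a ((beta - 1) * s - u.2) =
    (beta / 2) ^+ n * (beta / 2) ^+ n * \sum_(s <- subset_sums (powers beta n))
      \sum_(u <- subset_sums (powers beta n)) autocorr ramp a ((beta - 1) * (0 + s - u)).
  rewrite mulr_sumr; apply: eq_bigr => s _; rewrite big_map mulr_sumr.
  by apply: eq_bigr => u _ /=; rewrite add0r mulrBr.
rewrite /lam expr_div_n.
have -> : (4 : R) ^+ n = 2 ^+ n * 2 ^+ n by rewrite -exprMn -natrM.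
by field; rewrite !expf_neq0 ?gt_eqF.
Qed.

(** P 1_[0, L] is beta / 2 times the sum of the indicators of [0, L / beta] and
    [1 / beta, L].  For a <= 1 / beta it dominates beta / 2 times
    1_[0, a L] + 1_[0, L] - 1_[0, (1 - a) L], which is a beta 1_[0, L] plus
    centred functions.  Working with a rational [a] avoids intervals with
    endpoints that depend on the base. *)
Lemma transfer_le n a x : 0 <= a -> a * beta <= 1 ->
  a * beta * transfer n L x + beta / 2 * (discrepancy n a x - discrepancy n (1 - a) x)
  <= transfer n.+1 L x.
Proof.
move=> a0 ab; rewrite /discrepancy.
suff H : beta / 2 * (transfer n (a * L) x + transfer n L x - transfer n ((1 - a) * L) x)
    <= transfer n.+1 L x.
  apply: le_trans H; rewrite le_eqVlt; apply/orP; left; apply/eqP; by field.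
elim: n x => [|n IH] x; last first.
  rewrite [transfer n.+2 L x]transferS [transfer n.+1 (a * L) x]transferS.
  rewrite [transfer n.+1 L x]transferS [transfer n.+1 ((1 - a) * L) x]transferS.
  rewrite -mulrDr -mulrBr ler_wpM2l//; first by rewrite divr_ge0// ltW.
  have := IH (beta * x); have := IH (beta * x - 1).
  lra.
rewrite transferS !transfer0 ler_wpM2l//; first by rewrite divr_ge0// ltW.
have H1 : box 0 (a * L) x <= box 0 L (beta * x).
  rewrite /box; have [/andP[x0 xa]|_] := boolP (0 <= x <= a * L) => //.
  have -> : 0 <= beta * x <= L => //.
  apply/andP; split; first by apply: mulr_ge0 => //; exact: ltW.
  apply: (@le_trans _ _ (beta * (a * L))); first by apply: ler_wpM2l => //; exact: ltW.
  by rewrite mulrA ler_piMl 1?mulrC//; exact: ltW.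
have H2 : box 0 L x <= box 0 ((1 - a) * L) x + box 0 L (beta * x - 1).
  rewrite /box; have [/andP[x0 xL]|_] := boolP (0 <= x <= L); last by rewrite addr_ge0.
  have [xa|xa] := leP x ((1 - a) * L); first by rewrite x0/= lerDl.
  have -> : 0 <= beta * x - 1 <= L.
    rewrite subr_ge0 lerBlDr -betaL; apply/andP; split; last first.
      by apply: ler_wpM2l => //; exact: ltW.
    apply: (@le_trans _ _ (beta * ((1 - a) * L))); last first.
      by apply: ler_wpM2l; exact: ltW.
    have -> : beta * ((1 - a) * L) = (1 - a) * (beta * L) by ring.
    rewrite betaL.
    have bL : (beta - 1) * L = 1 by rewrite mulfV// gt_eqF// subr_gt0.
    have LL := L_gt0. nra.
  by rewrite lerDr.
lra.
Qed.

End weighted_counts.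

(** * Mean square decay of the discrepancy *)

Section sparse_digits.
Context {R : realType}.
Local Notation mu := (@lebesgue_measure R).
Variable beta : R.
Hypotheses (beta_gt1 : 1 < beta) (beta_lt2 : beta < 2).
Implicit Types (x c a : R) (n m : nat).

Let L : R := (beta - 1)^-1.
Let L_gt0 : 0 < L. Proof. by rewrite invr_gt0 subr_gt0. Qed.
Let beta_gt0 : 0 < beta. Proof. exact: lt_trans beta_gt1. Qed.

Lemma exists_root_lt1 (w : R) N : (0 < N)%N -> 0 < w < 1 ->
  exists2 k : R, 0 < k < 1 & k ^+ N = w.
Proof.
move=> N0 /andP[w0 w1]; exists (w `^ N%:R^-1); last first.
  rewrite -powR_mulrn ?powR_ge0// -powRrM mulVf ?pnatr_eq0 -?lt0n//.
  by rewrite powRr1// ltW.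
rewrite powR_gt0//=; have : w `^ N%:R^-1 < 1 `^ N%:R^-1.
  by apply: gt0_ltr_powR; rewrite ?invr_gt0 ?ltr0n ?nnegrE// ltW.
by rewrite powR1.
Qed.

(** The fourth power leaves room: [ae_discrepancy_le] spends one factor [k ^+ n]
    on summability, and the square of the lower bound for the counts is only of
    order [k ^+ (2 * n)]. *)
Definition discrepancy_decay (k : R) := forall a : rat, 0 <= (ratr a : R) <= 1 ->
  exists2 C : R, 0 <= C & forall n, exists2 I : R, I <= C * k ^+ (4 * n) &
    has_integral (fun x => discrepancy beta n (ratr a) x ^+ 2) I.

Lemma energy_decays_discrepancy : energy_decays beta ->
  exists2 k : R, 0 < k < 1 & discrepancy_decay k.
Proof.
move=> [q [tau [q0 zt H]]].
have z0 : 0 < beta ^+ q by rewrite exprn_gt0.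
have t0 : 0 < tau by exact: lt_trans zt.
have w01 : 0 < beta ^+ q / tau < 1 by rewrite divr_gt0//= ltr_pdivrMr// mul1r.
have [k k01 kw] := @exists_root_lt1 (beta ^+ q / tau) (4 * q) ltac:(lia) w01.
have /andP[k0 k1] := k01.
exists k => // a a01; have [C0 hC] := H a a01; have /andP[a0 a1] := a01.
have C00 : 0 <= C0.
  apply: le_trans (hC 0%N); rewrite expr0 mul1r; exact: energy_ge0.
exists (L * C0); first by apply: mulr_ge0 => //; exact: ltW.
move=> n; eexists; last exact: has_integral_sqr_discrepancy.
(* keep the digits whose index is a multiple of q *)
have [m /andP[nm _] le_energy] := davgs_powers_le beta n q0
  (posdef_autocorr (beta - 1) a0).
rewrite -!mulrA ler_wpM2l ?(ltW L_gt0)//.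
apply: (@le_trans _ _ ((beta ^+ q) ^+ m * energy q (ratr a) m beta)).
  apply: ler_pM.
  - exact: exprn_ge0 (ltW _).
  - by apply: posdef_davgs_ge0; exact: posdef_autocorr.
  - by rewrite -exprM ler_weXn2l// ltW.
  - exact: le_energy.
apply: (@le_trans _ _ (C0 * (beta ^+ q / tau) ^+ m)).
  have -> : C0 * (beta ^+ q / tau) ^+ m = (beta ^+ q) ^+ m * (C0 / tau ^+ m).
    by rewrite expr_div_n; ring.
  apply: ler_wpM2l; first exact: exprn_ge0 (ltW z0).
  by rewrite ler_pdivlMr ?exprn_gt0// mulrC.
rewrite ler_wpM2l// -kw -exprM; apply: ler_wiXn2l; rewrite ?ltW//.
by rewrite -mulnA leq_mul2l nm.
Qed.

End sparse_digits.

(** * Self-similar sets of positive measure *)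

Section affine_invariance.
Context {R : realType}.
Local Notation mu := (@lebesgue_measure R).

Lemma lebesgue_measure_itvcc (x y : R) : x <= y -> mu `[x, y] = (y - x)%:E.
Proof.
rewrite le_eqVlt => /predU1P[->|xy]; apply: etrans (lebesgue_measure_itv _) _.
  by rewrite /= lte_fin ltxx subrr.
by rewrite /= lte_fin xy EFinB.
Qed.

Lemma lebesgue_measure_affine (b s : R) (E : set (measurableTypeR R)) :
  0 < b -> measurable E ->
  mu ((fun y => b * y - s) @^-1` E) = (b^-1%:E * mu E)%E.
Proof.
move=> b0 mE; pose f : measurableTypeR R -> measurableTypeR R := fun y => b * y - s.
have mf : measurable_fun setT f.
  apply: measurable_funB => //; apply: measurable_funM => //.
have -> : mu E = (b%:E * mu (f @^-1` E))%E; last first.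
  by rewrite muleA -EFinM mulVf ?mul1e// gt_eqF.
apply: (@lebesgue_measure_unique R (mscale (NngNum (ltW b0))
  (measure_function_pushforward__canonical__measure_function_Measure mu mf))) => //.
move=> _ [[x y] _ <-] /=.
change (lebesgue_measure `]x, y] = (b%:E * mu (f @^-1` `]x, y]))%E).
have -> : f @^-1` `]x, y] = `](x + s) / b, (y + s) / b]%classic.
  apply/seteqP; split => t /=; rewrite !in_itv/= /f.
    by rewrite ltrBrDr lerBlDr ltr_pdivrMr// ler_pdivlMr// ![t * b]mulrC.
  by rewrite ltrBrDr lerBlDr ltr_pdivrMr// ler_pdivlMr// ![t * b]mulrC.
rewrite !lebesgue_measure_itv/= !lte_fin ltr_pM2r ?invr_gt0// ltrD2r.
case: ifPn => _; last by rewrite mule0.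
rewrite -!EFinB -EFinM; congr (_%:E); field; exact: lt0r_neq0.
Qed.

End affine_invariance.

Section self_similar_sets.
Context {R : realType}.
Local Notation mu := (@lebesgue_measure R).
Variable beta : R.
Hypotheses (beta_gt1 : 1 < beta) (beta_lt2 : beta < 2).
Let L : R := (beta - 1)^-1.
Let L_gt0 : 0 < L. Proof. by rewrite invr_gt0 subr_gt0. Qed.
Let beta_gt0 : 0 < beta. Proof. exact: lt_trans beta_gt1. Qed.
Let betaL : beta * L = L + 1.
Proof.
have h : beta - 1 != 0 by rewrite subr_eq0 gt_eqF.
by rewrite /L; field.
Qed.

Variable E : set (measurableTypeR R).
Hypotheses (mE : measurable E) (E_sub : E `<=` `[0, L])
  (E0 : forall x, E (beta * x) -> E x) (E1 : forall x, E (beta * x - 1) -> E x).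

(* Every point of [0, L] lies in a copy of [0, L] of size beta^-n whose
   corresponding copy of [E] is contained in [E]. *)
Let cylinder n x : 0 <= x <= L -> exists s, 0 <= beta ^+ n * x - s <= L /\
  forall y, E (beta ^+ n * y - s) -> E y.
Proof.
elim: n x => [|n IH] x /andP[x0 xL].
  by exists 0; rewrite expr0 mul1r subr0 x0 xL; split => // y; rewrite mul1r subr0.
have [d dI dE] : exists2 d, 0 <= beta * x - d <= L & forall y, E (beta * y - d) -> E y.
  have [xb|xb] := leP (beta * x) L.
    exists 0; first by rewrite subr0 xb andbT mulr_ge0// ltW.
    by move=> y; rewrite subr0; exact: E0.
  exists 1; last exact: E1.
  have b2 := beta_lt2; have L1 : 1 <= L by rewrite invf_ge1 ?subr_gt0//; lra.
  have : beta * x <= beta * L by rewrite ler_wpM2l// ltW.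
  by rewrite betaL; lra.
have [s [sI sE]] := IH _ dI.
exists (s + beta ^+ n * d).
have H y : beta ^+ n.+1 * y - (s + beta ^+ n * d) = beta ^+ n * (beta * y - d) - s.
  by rewrite exprSr; ring.
rewrite H; split => // y; rewrite H => /sE; exact: dE.
Qed.

(** Around a point outside [E], the ball of radius 2 L / beta^n contains a copy of
    [E] of measure mu E / beta^n.  So the complement of [E] has density at most
    1 - mu E / (4 L) along these radii, hence no point of density 1. *)
Lemma self_similar_conull : (0 < mu E)%E ->
  {ae mu, forall x, x \in `[0, L] -> E x}.
Proof.
move=> muE.
pose A := `[0, L] `\` E.
have mA : measurable (A : set (measurableTypeR R)) by exact: measurableD.
have fE : mu E \is a fin_num.
  have : (mu E <= mu `[0%R, L])%E by apply: le_measure; rewrite ?inE.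
  by rewrite lebesgue_measure_itvcc ?(ltW L_gt0)// ge0_fin_numE// => /le_lt_trans -> //; rewrite ltry.
have [e e0 eE] : exists2 e : R, 0 < e & mu E = e%:E.
  by exists (fine (mu E)); rewrite ?fineK// fine_gt0// muE/= ltey_eq fE.
have := lebesgue_density mA; apply: ae_imply => x Hx xI.
apply: contrapT => nE; move: Hx; rewrite indicE (mem_set (_ : A x))//=; move=> Hx.
pose r n : R := 2 * L / beta ^+ n.
have r0 n : 0 < r n by rewrite divr_gt0 ?mulr_gt0 ?exprn_gt0.
have Hr : (mu (A `&` ball x (r n)) * (mu (ball x (r n)))^-1)%E @[n --> \oo] --> 1%:E.
  have r_cvg : r @ \oo --> (0 : R).
    rewrite -[X in _ --> X](mulr0 (2 * L)); apply: cvgMr.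
    under eq_fun do rewrite -exprVn; apply: cvg_expr.
    by rewrite gtr0_norm ?invr_gt0// invf_lt1.
  have r_right : r @ \oo --> 0^'+.
    move=> P HP; have H : \forall n \near \oo, 0 < r n -> P (r n) by exact: (r_cvg _ HP).
    suff : \forall n \near \oo, P (r n) by [].
    by apply: filterS H => n; apply; exact: r0.
  exact: (cvg_comp _ _ r_right Hx).
have : (1%:E <= (1 - e / (4 * L))%:E)%E.
  rewrite -(cvg_lim _ Hr)//; apply: lime_le; first exact: cvgP Hr.
  apply: nearW => n; have rn := r0 n; have bn : 0 < beta ^+ n by rewrite exprn_gt0.
  rewrite lebesgue_measure_ball ?(ltW rn)// inver mulrn_eq0/= gt_eqF//.
  have xL : 0 <= x <= L by move: xI; rewrite in_itv.
  have [s [sI sE]] := cylinder n xL.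
  pose P := (fun y => beta ^+ n * y - s) @^-1` E.
  have mP : measurable (P : set (measurableTypeR R)).
    rewrite -[X in measurable X]setTI; apply: (_ : measurable_fun setT _) => //.
    by apply: measurable_funB => //; apply: measurable_funM.
  have muP : mu P = (e / beta ^+ n)%:E.
    by rewrite lebesgue_measure_affine// eE -EFinM mulrC.
  have P_ball : P `<=` ball x (r n).
    move=> y Py; have := E_sub Py; rewrite /= in_itv/= => yI.
    have h : `|beta ^+ n * (x - y)| <= L.
      move: yI sI => /andP[? ?] /andP[? ?]; rewrite ler_norml; lra.
    rewrite /ball/= /r; move: h; rewrite normrM gtr0_norm// -ler_pdivlMl//.
    move=> h; apply: (le_lt_trans h); rewrite [X in X < _]mulrC ltr_pM2r ?invr_gt0//.
    by have := L_gt0; lra.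
  have disj : (A `&` ball x (r n)) `&` P = set0.
    by apply/seteqP; split => // y [[[_ nEy] _] Py]; apply: nEy; exact: sE.
  have mAb : measurable (A `&` ball x (r n) : set (measurableTypeR R)).
    by apply: measurableI => //; exact: measurable_ball.
  have : (mu (A `&` ball x (r n)) + mu P <= (r n *+ 2)%:E)%E.
    rewrite -measureU// -(lebesgue_measure_ball x (ltW rn)).
    apply: le_measure; rewrite ?inE.
    - exact: measurableU.
    - exact: measurable_ball.
    - by move=> y [[]|/P_ball].
  rewrite muP -leeBrDr// -EFinB => H.
  apply: (@le_trans _ _ ((r n *+ 2 - e / beta ^+ n)%:E * ((r n *+ 2)^-1)%:E)%E).
    by apply: lee_wpmul2r => //; rewrite lee_fin invr_ge0 mulrn_wge0// ltW.
  rewrite -EFinM lee_fin le_eqVlt; apply/orP; left; apply/eqP.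
  by rewrite /r -mulr_natl; field; rewrite !gt_eqF.
rewrite lee_fin => H; have : 0 < e / (4 * L) by rewrite divr_gt0// mulr_gt0.
by lra.
Qed.

End self_similar_sets.

(** * Lower bound for the number of words *)

Section count_lower_bound.
Context {R : realType}.
Local Notation mu := (@lebesgue_measure R).
Variables beta k : R.
Hypotheses (beta_gt1 : 1 < beta) (beta_lt2 : beta < 2) (k01 : 0 < k < 1).
Hypothesis decay : discrepancy_decay beta k.
Implicit Types (x c a : R) (n m : nat).

Let L : R := (beta - 1)^-1.
Let L_gt0 : 0 < L. Proof. by rewrite invr_gt0 subr_gt0. Qed.
Let beta_gt0 : 0 < beta. Proof. exact: lt_trans beta_gt1. Qed.
Let k_gt0 : 0 < k. Proof. by case/andP: k01. Qed.
Let k_lt1 : k < 1. Proof. by case/andP: k01. Qed.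
Let T n := transfer beta n L.
Let V n a := discrepancy beta n a.
Let D : set (measurableTypeR R) := `[0, L]%classic.

Let measurable_sqr_discrepancy n (a : rat) : 0 <= (ratr a : R) <= 1 ->
  measurable_fun setT (fun x => V n (ratr a) x ^+ 2).
Proof.
move=> a01; have [C C0 hC] := decay a01; have [I _ [+ _]] := hC n.
by case/integrableP => /measurable_EFinP.
Qed.

Lemma ae_discrepancy_le (a : rat) : 0 <= (ratr a : R) <= 1 ->
  {ae mu, forall x, exists C : R, forall n, V n (ratr a) x ^+ 2 <= C * k ^+ (3 * n)}.
Proof.
move=> a01; have [C C0 hC] := decay a01.
pose f n x := k ^- (3 * n) * V n (ratr a) x ^+ 2.
have H : {ae mu, forall x, setT x -> exists C : R, forall n, f n x <= C}.
  apply: (@ae_bounded R setT f C k _ C0) => //.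
  - by rewrite (ltW k_gt0).
  - by move=> n x _; rewrite mulr_ge0 ?sqr_ge0// invr_ge0 exprn_ge0// ltW.
  - move=> n; apply: measurable_funM => //; exact: measurable_sqr_discrepancy.
  - move=> n; have [I hI /(has_integralZ (k ^- (3 * n))) [_ ->]] := hC n.
    rewrite lee_fin; apply: (@le_trans _ _ (k ^- (3 * n) * (C * k ^+ (4 * n)))).
      by rewrite ler_wpM2l// invr_ge0 exprn_ge0// ltW.
    rewrite mulrCA ler_wpM2l// le_eqVlt; apply/orP; left; apply/eqP.
    by rewrite (mulnDl 3 1) mul1n exprD mulKf// expf_neq0// gt_eqF.
apply: ae_imply H => x /(_ I)[C' hC']; exists C' => n.
by have := hC' n; rewrite /f mulrC ler_pdivrMr// exprn_gt0.
Qed.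

(** A lower bound that decays, but strictly slower than the discrepancies. *)
Definition slow_decay x := exists c : R, 0 < c /\
  exists N, forall n, (N <= n)%N -> c * k ^+ n <= T n x.

(* A rational slightly smaller than 1 / beta. *)
Let alpha_spec : exists2 a : rat, [/\ 0 <= (ratr a : R) <= 1, 0 <= (ratr (1 - a) : R) <= 1 &
  k <= ratr a * beta] & ratr a * beta <= 1.
Proof.
have kb : k / beta < beta^-1 by rewrite -[ltRHS]mul1r ltr_pM2r ?invr_gt0.
have [a /itvP aI] := rat_in_itvoo kb.
have b1 : beta^-1 <= 1 by rewrite invf_le1// ltW.
have a0 : 0 <= ratr a :> R.
  by apply: le_trans (_ : k / beta <= _); [rewrite divr_ge0 ?ltW|rewrite aI].
have a1 : ratr a <= 1 :> R by apply: le_trans b1; rewrite aI.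
exists a; last by rewrite -ler_pdivlMr// div1r aI.
split; first by rewrite a0 a1.
- by rewrite rmorphB rmorph1 subr_ge0 a1/= gerBl.
- by rewrite -ler_pdivrMr// aI.
Qed.

(* Bounds the discrepancies through their squares, the only quantities whose
   integrals are controlled. *)
Let loss (a : rat) n x : R := k ^- n.+1 *
  (k ^+ (2 * n) + k ^- (2 * n) * 2^-1 * (V n (ratr a) x ^+ 2 + V n (ratr (1 - a)) x ^+ 2)).

Let amgm n t : `|t| <= 2^-1 * (k ^+ (2 * n) + k ^- (2 * n) * t ^+ 2).
Proof.
have w0 : 0 < k ^+ (2 * n) by rewrite exprn_gt0.
move: (k ^+ (2 * n)) w0 => w w0.
rewrite -subr_ge0 -(real_normK (num_real t)); move: `|t| => u.
have -> : 2^-1 * (w + w^-1 * u ^+ 2) - u = 2^-1 * w^-1 * (w - u) ^+ 2.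
  by field; rewrite gt_eqF.
by rewrite mulr_ge0 ?sqr_ge0// mulr_ge0// invr_ge0 ltW.
Qed.

(** The counts normalised by k^-n can only decrease by a summable amount. *)
Lemma normalised_count_step : exists2 a : rat,
    0 <= (ratr a : R) <= 1 /\ 0 <= (ratr (1 - a) : R) <= 1 &
  forall n x, k ^- n * T n x - loss a n x <= k ^- n.+1 * T n.+1 x.
Proof.
have [a [a01 a01' ka ab]] := alpha_spec.
exists a => // n x; have /andP[a0 _] := a01.
have Hs := transfer_le beta_gt1 n x a0 ab.
have T0 : 0 <= T n x by exact: transfer_ge0.
rewrite -/(T n x) -/(T n.+1 x) -/(V n _ x) -/(V n _ x) in Hs.
have kn : 0 < k ^- n.+1 by rewrite invr_gt0 exprn_gt0.
have -> : k ^- n * T n x = k ^- n.+1 * (k * T n x).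
  have k0 : k != 0 by rewrite gt_eqF.
  by rewrite exprS; field; rewrite ?k0 ?expf_neq0.
rewrite /loss -mulrBr ler_pM2l//.
have -> : ratr (1 - a) = 1 - ratr a :> R by rewrite rmorphB rmorph1.
have V1 := amgm n (V n (ratr a) x); have V2 := amgm n (V n (1 - ratr a) x).
apply: le_trans Hs.
have kT : k * T n x <= ratr a * beta * T n x by exact: ler_wpM2r.
have b2 : beta / 2 <= 1 by have := beta_lt2; lra.
have b0 : 0 <= beta / 2 by rewrite divr_ge0// ltW.
set u := V n (ratr a) x in V1 *; set v := V n (1 - ratr a) x in V2 *.
have uv : - (`|u| + `|v|) <= beta / 2 * (u - v).
  have : `|beta / 2 * (u - v)| <= `|u| + `|v|.
    by rewrite normrM ger0_norm// (le_trans (ler_piMl _ b2))// ler_normB.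
  by rewrite ler_norml => /andP[].
lra.
Qed.

(** If [slow_decay] failed almost everywhere, the normalised count at time N would
    almost everywhere be at most the sum of the later losses.  But its integral is
    at least L for all N, while the integral of the losses after time N tends
    to 0. *)
Lemma not_ae_not_slow_decay :
  ~ {ae mu, forall x, x \in `[0, L] -> ~ slow_decay x}.
Proof.
have mD : measurable D by exact: measurable_itv.
have [a [a01 a01'] step] := normalised_count_step.
move=> H.
have [C C0 hC] := decay a01; have [C' C0' hC'] := decay a01'.
pose A := k^-1 * (L + 2^-1 * (C + C')).
have A0 : 0 <= A by rewrite mulr_ge0 ?invr_ge0 ?addr_ge0 ?(ltW k_gt0) ?(ltW L_gt0)// mulr_ge0// addr_ge0.
have loss_ge0 n x : 0 <= loss a n x.
  rewrite /loss mulr_ge0 ?invr_ge0 ?exprn_ge0 ?(ltW k_gt0)//.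
  by rewrite addr_ge0 ?mulr_ge0 ?invr_ge0 ?exprn_ge0 ?(ltW k_gt0)// addr_ge0 ?sqr_ge0.
have mloss n : measurable_fun [set: measurableTypeR R] (loss a n).
  apply: measurable_funM => //; apply: measurable_funD => //.
  apply: measurable_funM => //; apply: measurable_funD;
  exact: measurable_sqr_discrepancy.
have kn0 m : 0 < k ^+ m by rewrite exprn_gt0.
have intloss n : (\int[mu]_(x in D) (loss a n x)%:E <= (A * k ^+ n)%:E)%E.
  have [I hI HI] := hC n; have [I' hI' HI'] := hC' n.
  pose g x := k ^- n.+1 * (k ^+ (2 * n) * box 0 L x + k ^- (2 * n) * 2^-1 *
    (V n (ratr a) x ^+ 2 + V n (ratr (1 - a)) x ^+ 2)).
  have Hg := has_integralZ (k ^- n.+1) (has_integralD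
    (has_integralZ (k ^+ (2 * n)) (has_integral_box 0 L))
    (has_integralZ (k ^- (2 * n) * 2^-1) (has_integralD HI HI'))).
  have g0 x : 0 <= g x.
    rewrite /g mulr_ge0 ?invr_ge0 ?(ltW (kn0 _))// addr_ge0//.
      by rewrite mulr_ge0 ?(ltW (kn0 _)).
    by rewrite !mulr_ge0 ?invr_ge0 ?(ltW (kn0 _))// addr_ge0 ?sqr_ge0.
  have mg : measurable_fun [set: measurableTypeR R] g.
    have [/integrableP[h _] _] := Hg. exact: ((measurable_EFinP _ _).1 h).
  apply: (@le_trans _ _ (\int[mu]_x (g x)%:E)%E).
    rewrite (@eq_integral _ _ _ mu D (fun x => (g x)%:E)).
      apply: ge0_subset_integral => //; first by apply/measurable_EFinP.
      by move=> x _; rewrite lee_fin.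
    move=> x /[!inE] Dx; rewrite /g /loss /box.
    have xI : 0 <= x <= L by move: Dx; rewrite /D /= in_itv.
    by rewrite xI mulr1.
  case: Hg => _ ->; rewrite lee_fin subr0 ramp_pos ?(ltW L_gt0)//.
  have -> : A * k ^+ n = k ^- n.+1 *
      (k ^+ (2 * n) * L + k ^- (2 * n) * 2^-1 * (C * k ^+ (4 * n) + C' * k ^+ (4 * n))).
    rewrite /A exprS ![(_ * n)%N]mulnC !exprM.
    have w0 : k ^+ n != 0 by rewrite gt_eqF.
    have k0 : k != 0 by rewrite gt_eqF.
    move: (k ^+ n) w0 (L) => w w0 l; field.
    by rewrite w0 k0.
  rewrite ler_wpM2l ?invr_ge0 ?(ltW (kn0 _))// lerD2l ler_wpM2l ?lerD//.
  by rewrite mulr_ge0 ?invr_ge0 ?(ltW (kn0 _)).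
have dk : 0 < 1 - k by rewrite subr_gt0.
have [N hN] : exists N, A * k ^+ N / (1 - k) < L.
  have y0 : 0 <= A / ((1 - k) * L) by rewrite divr_ge0// mulr_ge0// ltW.
  have k1 : 1 < k^-1 by rewrite invf_gt1.
  have [N hN] := exists_expr_gt y0 k1; exists N.
  rewrite ltr_pdivrMr// [L * _]mulrC; move: hN.
  by rewrite exprVn ltr_pdivrMr ?mulr_gt0// [_^-1 * _]mulrC ltr_pdivlMr.
pose tail x : \bar R := (\sum_(0 <= i <oo) (loss a (N + i) x)%:E)%E.
have tail_ge0 x : (0 <= tail x)%E.
  by apply: nneseries_ge0 => i _ _; rewrite lee_fin.
have key x : ~ slow_decay x -> ((k ^- N * T N x)%:E <= tail x)%E.
  move=> nslow; rewrite leNgt; apply/negP => lt_tail; apply: nslow.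
  have tail_fin : tail x \is a fin_num.
    by rewrite ge0_fin_numE//; apply: lt_trans lt_tail _; rewrite ltry.
  pose t := fine (tail x).
  have tE : tail x = t%:E by rewrite fineK.
  exists (k ^- N * T N x - t); split; first by rewrite subr_gt0 -lte_fin -tE.
  exists N => n /subnKC <-; move: (n - N)%N => m.
  rewrite -ler_pdivlMr// [leRHS]mulrC.
  have partial : \sum_(0 <= i < m) loss a (N + i) x <= t.
    rewrite -lee_fin -tE -sumEFin.
    by apply: nneseries_lim_ge => i _ _; rewrite lee_fin.
  apply: (@le_trans _ _ (k ^- N * T N x - \sum_(0 <= i < m) loss a (N + i) x)).
    by rewrite lerB.
  elim: m {partial} => [|m IH]; first by rewrite big_geq// subr0 addn0.
  rewrite big_nat_recr//= opprD addrA addnS.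
  by apply: le_trans (step _ _); rewrite lerB.
have mT : measurable_fun [set: measurableTypeR R] (T N).
  have [/integrableP[+ _] _] := has_integral_transfer beta_gt1 N.
  by move=> ?; apply/measurable_EFinP.
have T0 x : 0 <= T N x by exact: transfer_ge0.
have intT : (\int[mu]_(x in D) (T N x)%:E = L%:E)%E.
  have [_ <-] := has_integral_transfer beta_gt1 N.
  rewrite integral_mkcond; apply: eq_integral => x _; rewrite /patch.
  by case: ifPn => // xD; rewrite transfer_out//; move: xD; rewrite /D mem_setE.
have : (\int[mu]_(x in D) (k ^- N * T N x)%:E <= \int[mu]_(x in D) tail x)%E.
  apply: ae_ge0_le_integral => //.
  - by move=> x _; rewrite lee_fin mulr_ge0 ?invr_ge0 ?(ltW (kn0 _)).
  - by apply/measurable_EFinP; apply: measurable_funM => //; exact: measurable_funTS.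
  - have M := @ge0_emeasurable_sum _ _ _ D (fun i x => (loss a (N + i) x)%:E) xpredT.
    apply: M => [i x _ _|i _]; first by rewrite lee_fin.
    by apply/measurable_EFinP; exact: measurable_funTS.
  - apply: ae_imply H => x Hx Dx; apply: key; apply: Hx; exact: Dx.
apply/negP; rewrite -ltNge.
apply: (@le_lt_trans _ _ (A * k ^+ N / (1 - k))%:E).
  rewrite /tail integral_nneseries//.
  - apply: nneseries_le_ub.
      by move=> i; apply: integral_ge0 => x _; rewrite lee_fin.
    move=> M; apply: (@le_trans _ _ (\sum_(0 <= i < M) ((A * k ^+ N) * k ^+ i)%:E)%E).
      by apply: lee_sum => i _; rewrite -mulrA -exprD.
    rewrite sumEFin lee_fin; apply: geometric_sum_le.
      by rewrite mulr_ge0// ltW.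
    by rewrite (ltW k_gt0).
  - by move=> i; apply/measurable_EFinP; exact: measurable_funTS.
  - by move=> i x _; rewrite lee_fin.
under eq_integral do rewrite EFinM.
rewrite ge0_integralZl_EFin//.
- rewrite intT -EFinM lte_fin; apply: lt_le_trans hN _.
  by rewrite ler_peMl ?(ltW L_gt0)// invf_ge1// exprn_ile1 ?ltW.
- by move=> x _; rewrite lee_fin.
- by apply/measurable_EFinP; exact: measurable_funTS.
- by rewrite invr_ge0 ltW.
Qed.

Let measurable_transfer n : measurable_fun [set: measurableTypeR R] (T n).
Proof.
have [/integrableP[+ _] _] := has_integral_transfer beta_gt1 n.
by move=> ?; apply/measurable_EFinP.
Qed.

Let E : set (measurableTypeR R) := D `&` [set x | slow_decay x].

Let measurable_E : measurable E.
Proof.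
have -> : E = D `&` \bigcup_j \bigcup_N \bigcap_(n in [set n | (N <= n)%N])
    [set x | j.+1%:R^-1 * k ^+ n <= T n x].
  rewrite /E; congr (_ `&` _); apply/seteqP; split => x /=.
    move=> [c [c0 [N hN]]].
    pose j := Num.bound c^-1.
    have cj : j.+1%:R^-1 <= c.
      rewrite -[leRHS]invrK lef_pV2 ?posrE ?invr_gt0//.
      have : c^-1 < j%:R by apply: archi_boundP; rewrite invr_ge0 ltW.
      by move=> /ltW /le_trans -> //; rewrite ler_nat.
    exists j => //; exists N => // n /= Nn; apply: le_trans (hN _ Nn).
    by rewrite ler_wpM2r// exprn_ge0// ltW.
  move=> [j _ [N _ H]]; exists j.+1%:R^-1; split; first by rewrite invr_gt0.
  by exists N => n Nn; exact: H.
apply: measurableI; first exact: measurable_itv.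
apply: bigcup_measurable => j _; apply: bigcup_measurable => N _.
apply: bigcap_measurable => [|n _]; first by exists N => /=.
have := @measurable_fun_le _ _ R setT (cst (j.+1%:R^-1 * k ^+ n)) (T n) measurableT.
by move=> /(_ (measurable_cst _) (measurable_transfer n)); rewrite setTI.
Qed.

Let slow_decay_pull x (e : bool) : slow_decay (beta * x - e%:R) -> slow_decay x.
Proof.
move=> [c [c0 [N hN]]]; exists (2^-1 * c); split; first by rewrite mulr_gt0.
exists N.+1 => -[//|n] Nn; rewrite /T transferS.
have Tn y : 0 <= transfer beta n L y by exact: transfer_ge0.
have := hN _ Nn; rewrite /T => h.
have h' : c * k ^+ n <= transfer beta n L (beta * x) + transfer beta n L (beta * x - 1).
  by clear hN; case: e h => h; rewrite ?subr0 in h; apply: le_trans h _; rewrite ?lerDr ?lerDl.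
have ck : c * k ^+ n.+1 <= c * k ^+ n.
  by rewrite ler_pM2l// exprS ler_piMl ?exprn_ge0 ?(ltW k_gt0)// ltW.
have ck0 : 0 <= c * k ^+ n by rewrite mulr_ge0 ?exprn_ge0 ?(ltW k_gt0)// ltW.
apply: (@le_trans _ _ (beta / 2 * (c * k ^+ n))).
  have := beta_gt1; nra.
by rewrite ler_wpM2l// divr_ge0// ltW.
Qed.

Lemma ae_slow_decay : {ae mu, forall x, x \in `[0, L] -> slow_decay x}.
Proof.
have pull x (e : bool) : E (beta * x - e%:R) -> E x.
  move=> [xI sx]; split; last exact: slow_decay_pull sx.
  move: xI; rewrite /D /= !in_itv/=.
  have b1 := beta_gt1; have L0 := L_gt0.
  have betaL : beta * L = L + 1.
    have h : beta - 1 != 0 by rewrite subr_eq0 gt_eqF.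
    by rewrite /L; field.
  have e0 : 0 <= (e%:R : R) <= 1 by case: e {sx}; rewrite ?lexx ler01.
  move: e0 => /andP[? ?] /andP[? ?]; apply/andP; split; nra.
have : (0 < mu E)%E.
  rewrite lt0e measure_ge0 andbT; apply/eqP => muE.
  apply: not_ae_not_slow_decay.
  exists E; split => // x /= /not_implyP[xI /contrapT sx]; split => //.
move=> /(self_similar_conull beta_gt1 beta_lt2 measurable_E _ _ _) H.
have {}H : {ae mu, forall x, x \in `[0, L] -> E x}.
  apply: H; first by move=> x [].
    by move=> x; have := pull x false; rewrite subr0.
  by move=> x; exact: pull x true.
by apply: ae_imply H => x Hx /Hx[].
Qed.

End count_lower_bound.

(** * Orbits, counts and empirical measures *)

Section empirical_measures.
Context {R : realType}.
Local Notation mu := (@lebesgue_measure R).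
Implicit Types (beta x c : R) (n : nat).

Lemma sum_tupleS (G : seq bool -> R) n :
  \sum_(w : n.+1.-tuple bool) G w =
  \sum_(w : n.-tuple bool) G (false :: w) + \sum_(w : n.-tuple bool) G (true :: w).
Proof.
rewrite (reindex (fun p : bool * n.-tuple bool => [tuple of p.1 :: p.2])) /=; last first.
  exists (fun w => (thead w, [tuple of behead w])) => [[d w] _|w _] /=.
    by rewrite theadE; congr pair; apply: val_inj.
  by rewrite [RHS]tuple_eta.
rewrite -(pair_bigA _ (fun d (w : n.-tuple bool) => G (d :: w))) /=.
by rewrite big_bool addrC.
Qed.

(** Both sides satisfy the recursion on the first letter. *)
Lemma transfer_words beta n c x : beta != 0 -> transfer beta n c x =
  (beta / 2) ^+ n * \sum_(w : n.-tuple bool) box 0 c (Tword beta w x).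
Proof.
move=> b0; elim: n x => [|n IH] x.
  rewrite transfer0 expr0 mul1r (big_pred1 [tuple]) => [//|w].
  by apply/esym/eqP; exact: tuple0.
rewrite transferS !IH -mulrDr mulrA (sum_tupleS (fun w => box 0 c (Tword beta w x))) exprS.
congr (_ * (_ + _)).
- by apply: eq_bigr => w _; rewrite /Tword /= /Tdigit subr0.
Qed.

Lemma sum_orbit beta n x (F : R -> R) :
  \sum_(y <- orbit_multiset beta x n) F y =
  \sum_(w : n.-tuple bool | Tword beta w x \in Ibeta beta) F (Tword beta w x).
Proof. by rewrite /orbit_multiset big_image. Qed.

Lemma orbit_in beta n x y : y \in orbit_multiset beta x n -> y \in Ibeta beta.
Proof. by move=> /mapP[w]; rewrite mem_enum inE => wI ->. Qed.

Definition orbit_mean beta x n (F : R -> R) : R :=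
  (orbit_count beta x n)%:R^-1 * \sum_(y <- orbit_multiset beta x n) F y.

Lemma orbit_mean_transfer beta x n c : 1 < beta -> c <= (beta - 1)^-1 ->
  orbit_mean beta x n (box 0 c) =
  transfer beta n c x / transfer beta n (beta - 1)^-1 x.
Proof.
move=> b1 cL; have b0 : 0 < beta by exact: lt_trans b1.
have E d : d <= (beta - 1)^-1 -> \sum_(y <- orbit_multiset beta x n) box 0 d y =
    \sum_(w : n.-tuple bool) box 0 d (Tword beta w x).
  move=> dL; rewrite sum_orbit big_mkcond; apply: eq_bigr => w _.
  case: ifPn => // wI; rewrite /box; case: (boolP (0 <= _ <= d)) => // /andP[w0 wd].
  by move: wI; rewrite /Ibeta in_itv/= w0 (le_trans wd dL).
rewrite /orbit_mean !transfer_words ?gt_eqF// E//.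
have -> : (orbit_count beta x n)%:R = \sum_(w : n.-tuple bool) box 0 (beta - 1)^-1 (Tword beta w x) :> R.
  rewrite -E// /orbit_count -sum1_size natr_sum; rewrite !big_seq.
  apply: eq_bigr => y /orbit_in; rewrite /Ibeta in_itv/= => yI.
  by rewrite /box yI.
by rewrite invfM mulrACA mulfV ?mul1r 1?mulrC// expf_neq0// mulf_neq0 ?gt_eqF.
Qed.

(** The integral against a sum of measures is available for nonnegative functions,
    whence the decomposition into positive and negative parts. *)
Lemma integral_orbit_measure beta x n (f : R -> R) : continuous f ->
  (\int[orbit_measure beta x n]_x (f x)%:E = (orbit_mean beta x n f)%:E)%E.
Proof.
move=> cf.
have mf : measurable_fun [set: measurableTypeR R] (EFin \o f).
  by apply/measurable_EFinP; exact: continuous_measurable_fun.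
have ge0E (g : R -> \bar R) : (forall y, (0 <= g y)%E) -> measurable_fun [set: measurableTypeR R] g ->
    (\int[orbit_measure beta x n]_x g x =
     (orbit_count beta x n)%:R^-1%:E * \sum_(y <- orbit_multiset beta x n) g y)%E.
  move=> g0 mg; rewrite ge0_integral_mscale//= ge0_integral_measure_sum//.
  congr (_ * _)%E; rewrite (big_nth 0%R) big_mkord; apply: eq_bigr => i _.
  by rewrite integral_dirac// diracT mul1e.
rewrite integralE !ge0E//; last 2 first.
- exact: measurable_funeneg.
- exact: measurable_funepos.
have E (s : seq R) (h : R -> R) : (\sum_(y <- s) (h y)%:E = (\sum_(y <- s) h y)%:E)%E.
  by rewrite sumEFin.
have P y : ((EFin \o f)^\+ y = (ramp (f y))%:E)%E by rewrite funeposE /= EFin_max.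
have N y : ((EFin \o f)^\- y = (ramp (- f y))%:E)%E by rewrite funenegE /= EFin_max.
under eq_bigr do rewrite P.
under [X in (_ - _ * X)%E]eq_bigr do rewrite N.
rewrite !E -!EFinM -EFinB -mulrBr -sumrB; congr (_ * _)%:E; apply: eq_bigr => y _.
by rewrite rampN; ring.
Qed.

Lemma integral_normalised_lebesgue beta (b1 : 1 < beta) (f : R -> R) : continuous f ->
  (\int[normalised_lebesgue b1]_x (f x)%:E =
   ((beta - 1) * \int[mu]_(x in `[0, (beta - 1)^-1]) f x)%:E)%E.
Proof.
move=> cf.
have mf : measurable_fun [set: measurableTypeR R] (EFin \o f).
  by apply/measurable_EFinP; exact: continuous_measurable_fun.
have ge0E (g : R -> \bar R) : (forall y, (0 <= g y)%E) -> measurable_fun [set: measurableTypeR R] g ->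
    (\int[normalised_lebesgue b1]_x g x =
     (beta - 1)%R%:E * \int[mu]_(x in `[0%R, (beta - 1)^-1%R]) g x)%E.
  move=> g0 mg; rewrite ge0_integral_mscale//=; congr (_ * _)%E.
  have mD := measurable_itv (Ibeta beta).
  rewrite (@ge0_negligible_integral _ _ _ (mrestr mu mD) setT (~` [set` Ibeta beta]))//; last 2 first.
  - exact: measurableC.
  - change (mu (~` [set` Ibeta beta] `&` [set` Ibeta beta]) = 0%E).
    by rewrite setICl measure0.
  rewrite setTD setCK; apply: eq_measure_integral => A mA AD.
  change (mu (A `&` [set` Ibeta beta]) = mu A).
  by rewrite (setIidl AD).
have If : mu.-integrable `[0, (beta - 1)^-1] (EFin \o f).
  by apply: continuous_at_itv_integrable => x _; exact: cf.
rewrite integralE !ge0E//; last 2 first.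
- exact: measurable_funeneg.
- exact: measurable_funepos.
rewrite EFinM fineK; last exact: integrable_fin_num.
rewrite [X in _ = (_ * X)%E](integralE mu).
have mD : measurable (`[0, (beta - 1)^-1]%classic : set (measurableTypeR R)).
  exact: measurable_itv.
have := integrable_pos_fin_num mD If; have := integrable_neg_fin_num mD If.
move: (\int[mu]_(x in _) _)%E (\int[mu]_(x in _) _)%E => u v fu fv.
case: u fu => // u _; case: v fv => // v _.
by rewrite -!EFinM -!EFinB mulrBr.
Qed.

End empirical_measures.

(** * Weak convergence from the distribution function *)

Section weak_convergence_from_cdf.
Context {R : realType}.
Local Notation mu := (@lebesgue_measure R).
Implicit Types (f : R -> R) (n m M : nat).

Lemma uniform_modulus f (L e : R) : continuous f -> 0 < L -> 0 < e ->
  exists M, forall y t, y \in `[0, L] -> `|t - y| <= L / M.+1%:R -> `|f t - f y| <= e.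
Proof.
move=> cf L0 e0.
have cK : compact (`[0, L]%classic : set R) by exact: segment_compact.
move/compact_near_coveringP: cK => cK.
have H : forall x, `[0, L]%classic x ->
    \forall x' \near x & M \near \oo, forall t, `|t - x'| <= L / M.+1%:R -> `|f t - f x'| <= e.
  move=> x _.
  have e2 : 0 < e / 2 by rewrite divr_gt0.
  have /cvgrPdist_lt /(_ _ e2) := cf x.
  move=> [d /= d0 hd].
  have d2 : 0 < d / 2 by rewrite divr_gt0.
  exists (ball x (d / 2), [set M | L / M.+1%:R < d / 2]).
    split => /=; first exact: nbhsx_ballx.
    exists (Num.bound (L / (d / 2))) => // M /= hM.
    rewrite ltr_pdivrMr// mulrC -ltr_pdivrMr//.
    apply: (@lt_le_trans _ _ (Num.bound (L / (d / 2)))%:R).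
      by apply: archi_boundP; rewrite divr_ge0// ltW.
    by rewrite ler_nat; apply: leq_trans hM _.
  move=> [y M] /= [xy hM] t ty.
  have h1 := hd y _; have h2 := hd t _.
  have : `|f x - f y| < e / 2 by apply: h1; rewrite /ball_/=; move: xy; rewrite /ball/= => xy; lra.
  have : `|f x - f t| < e / 2.
    apply: h2; rewrite /ball_/=; move: xy; rewrite /ball/= => xy.
    have -> : x - t = (x - y) - (t - y) by ring.
    have ty2 := le_lt_trans ty hM; clear ty hM.
    by apply: le_lt_trans (ler_normB _ _) _; lra.
  have -> : f t - f y = (f x - f y) - (f x - f t) by ring.
  by move=> u v; apply: le_trans (ler_normB _ _) _; lra.
have [M _ hM] := cK nat \oo (fun M y => forall t, `|t - y| <= L / M.+1%:R -> `|f t - f y| <= e) _ H.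
by exists M => y t yI; apply: (hM M) => //=.
Qed.

(** A step function built on the indicators of [0, i L / M], i < m: it equals
    [f (i L / M)] on the i-th cell, by telescoping. *)
Definition step_approx f (L : R) M m (y : R) : R :=
  \sum_(i < m) (f (i%:R / M%:R * L) - f (i.+1%:R / M%:R * L)) * box 0 (i%:R / M%:R * L) y
  + f (m%:R / M%:R * L).

Lemma step_approx_le f (L e : R) M m y : (0 < M)%N -> 0 < L -> 0 <= e -> 
  (forall y t, y \in `[0, L] -> `|t - y| <= L / M%:R -> `|f t - f y| <= e) ->
  (m <= M)%N -> 0 <= y <= m%:R / M%:R * L -> `|f y - step_approx f L M m y| <= e.
Proof.
move=> M0 L0 e0 hf; have Mp : 0 < M%:R :> R by rewrite ltr0n.
elim: m y => [|m IH] y mM.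
  rewrite mul0r mul0r => /andP[y0 y1]; have -> : y = 0 by apply/eqP; rewrite eq_le y0 y1.
  by rewrite /step_approx big_ord0 add0r !mul0r subrr normr0.
move=> /andP[y0 y1].
rewrite /step_approx big_ord_recr/=; have [ym|ym] := leP y (m%:R / M%:R * L).
  have -> : box 0 (m%:R / M%:R * L) y = 1 by rewrite /box y0 ym.
  rewrite mulr1 -addrA subrK; apply: IH; [exact: ltnW|by rewrite y0 ym].
rewrite big1 => [|i _].
  have -> : box 0 (m%:R / M%:R * L) y = 0 by rewrite /box y0 leNgt ym.
  rewrite mulr0 !add0r distrC; apply: hf.
    rewrite in_itv/= y0/=; apply: le_trans y1 _.
    apply: ler_piMl; first exact: ltW.
    by rewrite ler_pdivrMr// mul1r ler_nat.
  rewrite ger0_norm ?subr_ge0//.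
  have -> : m.+1%:R / M%:R * L = m%:R / M%:R * L + L / M%:R.
    by rewrite -natr1; ring.
  by lra.
have im : i%:R / M%:R * L < y.
  apply: le_lt_trans ym; apply: ler_wpM2r; first exact: ltW.
  apply: ler_wpM2r; first by rewrite invr_ge0 ltW.
  by rewrite ler_nat ltnW.
by rewrite /box y0 leNgt im mulr0.
Qed.

Variables (beta x : R).
Hypotheses (beta_gt1 : 1 < beta) (beta_lt2 : beta < 2) (xI : x \in Ibeta beta).
Let L : R := (beta - 1)^-1.
Let L_gt0 : 0 < L. Proof. by rewrite invr_gt0 subr_gt0. Qed.
Hypothesis cdf : forall a : rat, 0 <= (ratr a : R) <= 1 ->
  orbit_mean beta x n (box 0 (ratr a * L)) @[n --> \oo] --> (ratr a : R).

Let mean n (F : R -> R) := orbit_mean beta x n F.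

Let meanD n F G : mean n (fun y => F y + G y) = mean n F + mean n G.
Proof. by rewrite /mean /orbit_mean big_split mulrDr. Qed.

Let meanZ n c F : mean n (fun y => c * F y) = c * mean n F.
Proof. by rewrite /mean /orbit_mean -mulr_sumr mulrCA. Qed.

Let mean_sum n m (F : 'I_m -> R -> R) :
  mean n (fun y => \sum_(i < m) F i y) = \sum_(i < m) mean n (F i).
Proof. by rewrite /mean /orbit_mean exchange_big mulr_sumr. Qed.

Let count_gt0 n : 0 < (orbit_count beta x n)%:R :> R.
Proof. by rewrite ltr0n orbit_count_gt0// beta_gt1. Qed.

Let mean_cst n c : mean n (cst c) = c.
Proof.
rewrite /mean /orbit_mean big_const_seq count_predT iter_addr_0 -/(orbit_count _ _ _).
by rewrite -[c *+ _]mulr_natr mulrCA mulVf ?mulr1// gt_eqF.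
Qed.

Let mean_le n F G e : (forall y, y \in `[0, L] -> `|F y - G y| <= e) ->
  `|mean n F - mean n G| <= e.
Proof.
move=> FG; rewrite /mean /orbit_mean -mulrBr -sumrB normrM normfV (gtr0_norm (count_gt0 n)).
rewrite mulrC ler_pdivrMr//; apply: le_trans (ler_norm_sum _ _ _) _.
apply: (@le_trans _ _ (\sum_(y <- orbit_multiset beta x n) e)).
  rewrite !big_seq; apply: ler_sum => y /orbit_in yI; exact: FG.
by rewrite big_const_seq count_predT iter_addr_0 -/(orbit_count _ _ _) mulr_natr.
Qed.

Let I (F : R -> R) : R := (beta - 1) * \int[mu]_(y in `[0, L]) F y.

Let bL : (beta - 1) * L = 1. Proof. by rewrite mulfV// gt_eqF// subr_gt0. Qed.

Let box_integral c : 0 <= c <= 1 ->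
  mu.-integrable `[0, L] (EFin \o box 0 (c * L)) /\ I (box 0 (c * L)) = c.
Proof.
move=> /andP[c0 c1]; have [Ib Hb] := has_integral_box 0 (c * L).
have cL : 0 <= c * L <= L by rewrite mulr_ge0 ?(ltW L_gt0)//= ler_piMl// ltW.
split; first exact: integrableS Ib.
rewrite /I /Rintegral integral_mkcond.
rewrite (@eq_integral _ _ _ mu setT (EFin \o box 0 (c * L))).
  rewrite Hb subr0 ramp_pos ?(andP cL).1// mulrCA bL mulr1//.
move=> y _; rewrite /patch; case: ifPn => // yI; rewrite /= /box.
case: (boolP (0 <= y <= c * L)) => // /andP[y0 yc].
move: yI; rewrite mem_setE in_itv/= y0/= (le_trans yc)//.
by case/andP: cL.
Qed.

(** Up to epsilon, a continuous function is a combination of indicators of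
    intervals [0, a L] with rational [a]. *)
Lemma orbit_mean_cvg f : continuous f ->
  mean n f @[n --> \oo] --> I f.
Proof.
move=> cf; apply/cvgrPdist_le => e e0.
have e3 : 0 < e / 3 by rewrite divr_gt0.
have [M hM] := uniform_modulus cf L_gt0 e3.
set N := M.+1 in hM.
pose c (i : nat) := f (i%:R / N%:R * L) - f (i.+1%:R / N%:R * L).
pose a (i : nat) : rat := i%:R / N%:R.
have aE i : ratr (a i) = i%:R / N%:R :> R by rewrite /a rmorphM fmorphV !rmorph_nat.
have a01 (i : nat) : (i <= N)%N -> 0 <= (ratr (a i) : R) <= 1.
  move=> iN; rewrite aE divr_ge0//= ler_pdivrMr ?ltr0n// mul1r ler_nat//.
pose G y := \sum_(i < N) c i * box 0 (ratr (a i) * L) y + f L.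
have fG y : y \in `[0, L] -> `|f y - G y| <= e / 3.
  move=> yI; have NN : N%:R / N%:R = 1 :> R by rewrite mulfV// pnatr_eq0.
  have -> : G y = step_approx f L N N y.
    rewrite /G /step_approx NN mul1r; congr (_ + _); apply: eq_bigr => i _.
    by rewrite aE.
  apply: (step_approx_le _ _ _ hM) => //; first exact: ltW.
  by rewrite NN mul1r; move: yI; rewrite in_itv.
have Ic d : mu.-integrable `[0, L] (EFin \o cst d).
  by apply: continuous_at_itv_integrable => y _; exact: cst_continuous.
have Icst d : I (cst d) = d.
  by rewrite /I Rintegral_cst//= lebesgue_measure_itvcc ?(ltW L_gt0)//= subr0 mulrCA bL mulr1.
have mD : measurable (`[0, L]%classic : set (measurableTypeR R)).
  exact: measurable_itv.
have IGsum m : (m <= N)%N ->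
    let S y := \sum_(i < m) c i * box 0 (ratr (a i) * L) y in
    mu.-integrable `[0, L] (EFin \o S) /\ I S = \sum_(i < m) c i * ratr (a i).
  elim: m => [|m IH] mN /=.
    rewrite big_ord0 (_ : (fun y => _) = cst 0); last by apply/funext => y; rewrite big_ord0.
    by split; [exact: Ic|exact: Icst].
  have [iS IS] := IH (ltnW mN).
  have [ib Ib] := box_integral (a01 m (ltnW mN)).
  have iZ : mu.-integrable `[0, L] (EFin \o (fun y => c m * box 0 (ratr (a m) * L) y)).
    by have := integrableZl mD (c m) ib; apply: eq_integrable.
  rewrite (_ : (fun y => _) = (fun y => (\sum_(i < m) c i * box 0 (ratr (a i) * L) y) +
      c m * box 0 (ratr (a m) * L) y)); last by apply/funext => y; rewrite big_ord_recr.
  split; first by have := integrableD mD iS iZ; apply: eq_integrable.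
  rewrite big_ord_recr /= -IS -[in RHS]Ib /I RintegralD// RintegralZl//.
  by rewrite mulrDr mulrCA.
have [iS IS] := IGsum N (leqnn N).
have iG : mu.-integrable `[0, L] (EFin \o G).
  by have := integrableD mD iS (Ic (f L)); apply: eq_integrable.
have IG : I G = \sum_(i < N) c i * ratr (a i) + f L.
  by rewrite -IS -[in RHS](Icst (f L)) /I -mulrDr -RintegralD.
have iF : mu.-integrable `[0, L] (EFin \o f).
  by apply: continuous_at_itv_integrable => y _; exact: cf.
have If : `|I f - I G| <= e / 3.
  rewrite /I -mulrBr -RintegralB// normrM ger0_norm ?subr_ge0 ?(ltW beta_gt1)//.
  have iB : mu.-integrable `[0, L] (EFin \o (fun y => f y - G y)).
    by have := integrableB mD iF iG; apply: eq_integrable.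
  rewrite -[leRHS](Icst (e / 3)) /I; apply: ler_wpM2l.
    by rewrite subr_ge0 ltW.
  apply: le_trans (le_normr_Rintegral mD iB) _; apply: le_Rintegral => //.
  by have := integrable_norm iB.
have mG : mean n G @[n --> \oo] --> I G.
  have -> : mean ^~ G = (fun n => \sum_(i < N) c i * mean n (box 0 (ratr (a i) * L)) + f L).
    apply/funext => n; rewrite /G meanD mean_cst mean_sum; congr (_ + _).
    by apply: eq_bigr => i _; rewrite meanZ.
  rewrite IG; apply: cvgD; last exact: cvg_cst.
  apply: cvg_big => [|i _]; first exact: add_continuous.
  by apply: cvgMr; apply: cdf; apply: a01; exact: ltnW.
move/cvgrPdist_le: mG => /(_ _ e3); apply: filterS => n hn.
have h1 := mean_le n fG.
have -> : I f - mean n f = (I f - I G) + (I G - mean n G) - (mean n f - mean n G) by ring.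
apply: le_trans (ler_normB _ _) _.
have := ler_normD (I f - I G) (I G - mean n G).
by lra.
Qed.

End weak_convergence_from_cdf.

(** * Equidistribution of orbits *)

Section equidistribution.
Context {R : realType}.
Local Notation mu := (@lebesgue_measure R).

(** The distance to [a] is the quotient of the discrepancy, of order at most
    k^(3n/2), by the count, of order at least k^n. *)
Lemma orbit_cdf_cvg (beta k x : R) (a : rat) : 1 < beta -> 0 < k < 1 ->
  ratr a <= (1 : R) -> slow_decay beta k x ->
  (exists C : R, forall n, discrepancy beta n (ratr a) x ^+ 2 <= C * k ^+ (3 * n)) ->
  orbit_mean beta x n (box 0 (ratr a * (beta - 1)^-1)) @[n --> \oo] --> (ratr a : R).
Proof.
move=> b1 /andP[k0 k1] a1 [c [c0 [N hN]]] [C hC].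
have L0 : 0 < (beta - 1)^-1 by rewrite invr_gt0 subr_gt0.
apply/cvgrPdist_le => e e0.
have C1 : 0 < `|C| + 1 by rewrite ltr_wpDl.
have ce : 0 < (e * c) ^+ 2 / (`|C| + 1) by rewrite divr_gt0// exprn_gt0// mulr_gt0.
have kcvg : k ^+ n @[n --> \oo] --> (0 : R) by apply: cvg_expr; rewrite gtr0_norm.
move/cvgrPdist_lt: kcvg => /(_ _ ce) kn.
near=> n.
have nN : (N <= n)%N by near: n; exact: nbhs_infty_ge.
have : `|0 - k ^+ n| < (e * c) ^+ 2 / (`|C| + 1) by near: n.
have kn0 : 0 < k ^+ n by rewrite exprn_gt0.
rewrite sub0r normrN gtr0_norm// ltr_pdivlMr// => kne.
have Tn : c * k ^+ n <= transfer beta n (beta - 1)^-1 x by exact: hN.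
have Tn0 : 0 < transfer beta n (beta - 1)^-1 x.
  by apply: lt_le_trans Tn; rewrite mulr_gt0.
rewrite orbit_mean_transfer//; last by rewrite ler_piMl// ltW.
rewrite distrC.
have -> : transfer beta n (ratr a * (beta - 1)^-1) x / transfer beta n (beta - 1)^-1 x - ratr a
    = discrepancy beta n (ratr a) x / transfer beta n (beta - 1)^-1 x.
  by rewrite /discrepancy; field; rewrite !gt_eqF// subr_gt0.
rewrite normrM normfV (gtr0_norm Tn0) ler_pdivrMr//.
apply: (@le_trans _ _ (e * (c * k ^+ n))); last by rewrite ler_wpM2l// ltW.
rewrite -(@ler_pXn2r _ 2)// ?nnegrE//; last by rewrite !mulr_ge0// ltW.
rewrite real_normK ?num_real//; apply: le_trans (hC n) _.
apply: (@le_trans _ _ ((`|C| + 1) * k ^+ (3 * n))).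
  rewrite ler_wpM2r ?exprn_ge0 ?(ltW k0)//.
  by apply: le_trans (ler_norm C) _; rewrite lerDl.
have -> : k ^+ (3 * n) = k ^+ n * (k ^+ n) ^+ 2 by rewrite mulnC exprM exprS.
have -> : (e * (c * k ^+ n)) ^+ 2 = (e * c) ^+ 2 * (k ^+ n) ^+ 2 by ring.
rewrite [leLHS]mulrA; apply: ler_wpM2r; first exact: sqr_ge0.
by rewrite mulrC; exact: ltW.
Unshelve. all: by end_near. Qed.

Lemma ae_weakly_converges (beta : R) (b1 : 1 < beta) : beta < 2 ->
  energy_decays beta ->
  {ae mu, forall x : R, x \in Ibeta beta ->
    weakly_converges (fun n : nat => orbit_measure beta x n) (normalised_lebesgue b1)}.
Proof.
move=> b2 eb; have [k k01 decay] := energy_decays_discrepancy b1 b2 eb.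
have H1 := ae_slow_decay b1 b2 k01 decay.
have H2 : {ae mu, forall x, forall a : rat, 0 <= (ratr a : R) <= 1 ->
    exists C : R, forall n, discrepancy beta n (ratr a) x ^+ 2 <= C * k ^+ (3 * n)}.
  apply: ae_countable => a.
  have [a01|na] := boolP (0 <= (ratr a : R) <= 1); last exact: aeW.
  by apply: ae_imply (ae_discrepancy_le k01 decay a01) => x.
apply: ae_imply (ae_and H1 H2) => x [sx dx] xI f cf _.
rewrite integral_normalised_lebesgue//.
under eq_fun do rewrite integral_orbit_measure//.
apply: cvg_EFin; first exact: nearW.
apply: orbit_mean_cvg => // a a01.
apply: orbit_cdf_cvg b1 k01 _ (sx xI) (dx a a01).
by case/andP: a01.
Qed.

End equidistribution.

Theorem theorem5p2 (R : realType) :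
  {ae (@lebesgue_measure R), forall (beta : R) (b1 : 1 < beta),
    beta < Num.sqrt 2 ->
    {ae (@lebesgue_measure R), forall x : R, x \in Ibeta beta ->
      weakly_converges (fun n : nat => orbit_measure beta x n)
                       (normalised_lebesgue b1)}}.
Proof.
apply: ae_imply (@ae_energy_decays R) => beta H b1 bs.
have b0 : 0 < beta by exact: lt_trans b1.
have b2 : beta ^+ 2 < 2.
  by rewrite -[ltRHS]sqr_sqrtr// ltr_pXn2r// nnegrE ?sqrtr_ge0// ltW.
apply: ae_weakly_converges; last exact: H.
by move: b2; rewrite expr2 => b2; nra.
Qed.
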